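(* Let $K$ be a field and $\mathbb M$ a $\mathcal K$-module. Then $\mathbb M$ is reflexive if and only if $\mathbb M$ is the inverse limit of its quasi-coherent quotient modules, i.e. the family $\{\mathcal N_i\}_{i\in I}$ of all quasi-coherent quotient modules of $\mathbb M$ is a set, downward directed, and the natural morphism $\mathbb M\to\varprojlim_{i\in I}\mathcal N_i$ is an isomorphism.
   Context: For a commutative ring $R$ (here $R=K$), an $\mathcal R$-module is a covariant functor $\mathbb M$ from commutative $R$-algebras to abelian groups with each $\mathbb M(S)$ an $S$-module, functorially; morphisms are natural transformations $S$-linear on each $S$; limits are computed objectwise. For an $R$-module $N$, $\mathcal N(S)=N\otimes_R S$ (quasi-coherent module). A quasi-coherent quotient of $\mathbb M$ is an epimorphism $\mathbb M\to\mathcal N$ (surjective on each $S$) onto a quasi-coherent module, up to isomorphism under $\mathbb M$; they are ordered by $\mathcal N_j\le\mathcal N_i$ if $\mathbb M\to\mathcal N_i$ factors through $\mathbb M\to\mathcal N_j$. $\mathbb M^*(S)=\operatorname{Hom}_{\mathcal S}(\mathbb M_{|S},\mathcal S)$ where $\mathbb M_{|S}$ is restriction to $S$-algebras; $\mathbb M$ is reflexive if the natural morphism $\mathbb M\to\mathbb M^{**}$ is an isomorphism. *)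

(* Defs.v *)
From HB Require Import structures.
From mathcomp Require Import all_boot all_order all_algebra.
Set Implicit Arguments. Unset Strict Implicit. Unset Printing Implicit Defensive.
Import GRing.Theory.
Local Open Scope ring_scope.

Section KModules.
Variable K : fieldType.

Definition kalg_hom (S T : comAlgType K) (f : S -> T) : Prop :=
  [/\ {morph f : x y / x + y}, {morph f : x y / x * y}, f 1 = 1 &
      forall (k : K) x, f (k *: x) = k *: f x].

(* A K-module in the functorial sense: a functor S |-> M(S) (an S-module)
   from commutative K-algebras, with M(f) additive and f-semilinear.  The
   action map is given on all functions but only constrained on K-algebra
   morphisms. *)
Record kmodule := KModule {
  kobj :> forall S : comAlgType K, lmodType S;
  kmap : forall (S T : comAlgType K), (S -> T) -> kobj S -> kobj T;
  kmap_add : forall (S T : comAlgType K) (f : S -> T), kalg_hom f ->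
     forall x y, kmap f (x + y) = kmap f x + kmap f y;
  kmap_scale : forall (S T : comAlgType K) (f : S -> T), kalg_hom f ->
     forall (s : S) x, kmap f (s *: x) = f s *: kmap f x;
  kmap_id : forall (S : comAlgType K) (x : kobj S), kmap (fun s : S => s) x = x;
  kmap_comp : forall (S T U : comAlgType K) (f : S -> T) (g : T -> U), kalg_hom f -> kalg_hom g ->
     forall x, kmap (fun s => g (f s)) x = kmap g (kmap f x)
}.
Arguments kmap k [S T] f x.

Definition is_kmor (M N : kmodule) (eta : forall S, M S -> N S) : Prop :=
  [/\ forall (S : comAlgType K) (x y : M S), eta S (x + y) = eta S x + eta S y,
      forall (S : comAlgType K) (s : S) (x : M S), eta S (s *: x) = s *: eta S x &
      forall (S T : comAlgType K) (f : S -> T), kalg_hom f ->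
        forall x, eta T (kmap M f x) = kmap N f (eta S x)].

Definition kstr (S : comAlgType K) : K^o -> S := fun k => k%:A.

(* N is quasi-coherent, i.e. N(S) = N(K) (x)_K S naturally: for every S the
   K-linear map N(K) -> N(S) induced by K -> S is the universal K-linear map
   of N(K) into an S-module (universal property of the base change). *)
Definition quasi_coherent (N : kmodule) : Prop :=
  forall (S : comAlgType K) (V : lmodType S) (g : N K^o -> V),
    (forall x y, g (x + y) = g x + g y) ->
    (forall (k : K) x, g (k *: x) = kstr S k *: g x) ->
    exists h : N S -> V,
      [/\ forall x y, h (x + y) = h x + h y,
          forall (s : S) x, h (s *: x) = s *: h x,
          forall x, h (kmap N (kstr S) x) = g x &
          forall h' : N S -> V,
            (forall x y, h' (x + y) = h' x + h' y) ->
            (forall (s : S) x, h' (s *: x) = s *: h' x) ->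
            (forall x, h' (kmap N (kstr S) x) = g x) ->
            forall y, h' y = h y].

Definition qc_quotient (M N : kmodule) (q : forall S, M S -> N S) : Prop :=
  [/\ is_kmor q, forall S (y : N S), exists x, q S x = y & quasi_coherent N].

(* q' : M -> N' factors through q : M -> N  (i.e. N <= N' in the paper's order) *)
Definition factors_through (M N N' : kmodule)
    (q' : forall S, M S -> N' S) (q : forall S, M S -> N S) : Prop :=
  exists f : forall S, N S -> N' S, is_kmor f /\ forall S x, f S (q S x) = q' S x.

(* raw elements of M^*(T): for each T-algebra (U, tau : T -> U) a map M(U) -> U *)
Definition dual_raw (M : kmodule) (T : comAlgType K) :=
  forall U : comAlgType K, (T -> U) -> M U -> U.

(* w is an element of M^*(T) = Hom_T(M_|T, T) *)
Definition dual_elt (M : kmodule) (T : comAlgType K) (w : dual_raw M T) : Prop :=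
  forall (U : comAlgType K) (tau : T -> U), kalg_hom tau ->
  [/\ forall x y, w U tau (x + y) = w U tau x + w U tau y,
      forall (u : U) x, w U tau (u *: x) = u * w U tau x &
      forall (U' : comAlgType K) (h : U -> U') (tau' : T -> U'), kalg_hom h ->
        (forall t, h (tau t) = tau' t) ->
        forall x, w U' tau' (kmap M h x) = h (w U tau x)].

Definition dual_eq (M : kmodule) (T : comAlgType K) (w w' : dual_raw M T) : Prop :=
  forall (U : comAlgType K) (tau : T -> U), kalg_hom tau -> forall x, w U tau x = w' U tau x.

Definition dual_add (M : kmodule) T (w w' : dual_raw M T) : dual_raw M T :=
  fun U tau x => w U tau x + w' U tau x.
Definition dual_scale (M : kmodule) (T : comAlgType K) (t : T) (w : dual_raw M T) : dual_raw M T :=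
  fun U tau x => tau t * w U tau x.
Definition dual_map (M : kmodule) (T T' : comAlgType K) (g : T -> T') (w : dual_raw M T) :
  dual_raw M T' := fun U tau x => w U (fun t => tau (g t)) x.

(* raw elements of M^**(S): for each S-algebra (T, sigma) a map M^*(T) -> T *)
Definition bidual_raw (M : kmodule) (S : comAlgType K) :=
  forall T : comAlgType K, (S -> T) -> dual_raw M T -> T.

(* Phi is an element of M^**(S) = Hom_S(M^*_|S, S) *)
Definition bidual_elt (M : kmodule) (S : comAlgType K) (Phi : bidual_raw M S) : Prop :=
  forall (T : comAlgType K) (sigma : S -> T), kalg_hom sigma ->
  [/\ forall w w', dual_elt w -> dual_elt w' -> dual_eq w w' ->
        Phi T sigma w = Phi T sigma w',
      forall w w', dual_elt w -> dual_elt w' ->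
        Phi T sigma (dual_add w w') = Phi T sigma w + Phi T sigma w',
      forall (t : T) w, dual_elt w ->
        Phi T sigma (dual_scale t w) = t * Phi T sigma w &
      forall (T' : comAlgType K) (g : T -> T') (sigma' : S -> T'), kalg_hom g ->
        (forall s, g (sigma s) = sigma' s) ->
        forall w, dual_elt w -> Phi T' sigma' (dual_map g w) = g (Phi T sigma w)].

Definition bidual_eq (M : kmodule) (S : comAlgType K) (Phi Phi' : bidual_raw M S) : Prop :=
  forall (T : comAlgType K) (sigma : S -> T), kalg_hom sigma ->
  forall w : dual_raw M T, dual_elt w -> Phi T sigma w = Phi' T sigma w.

Definition bidual_ev (M : kmodule) (S : comAlgType K) (m : M S) : bidual_raw M S :=
  fun T sigma w => w T (fun t => t) (kmap M sigma m).

Definition kreflexive (M : kmodule) : Prop :=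
  forall S : comAlgType K,
    (forall m m' : M S, bidual_eq (bidual_ev m) (bidual_ev m') -> m = m') /\
    (forall Phi : bidual_raw M S, bidual_elt Phi ->
       exists m : M S, bidual_eq (bidual_ev m) Phi).

(* the class of quasi-coherent quotients (up to isomorphism under M) is a set:
   it is indexed by a small type (same universe as the module carriers) *)
Definition qc_quotients_small (M : kmodule) : Prop :=
  exists (I : Type@{GRing.Lmodule.axioms_.u0}) (N : I -> kmodule)
         (q : forall i S, M S -> N i S),
    (forall i, qc_quotient (q i)) /\
    (forall (N' : kmodule) (q' : forall S, M S -> N' S), qc_quotient q' ->
       exists i, factors_through q' (q i) /\ factors_through (q i) q').

Definition qc_quotients_directed (M : kmodule) : Prop :=
  forall (N1 N2 : kmodule) (q1 : forall S, M S -> N1 S) (q2 : forall S, M S -> N2 S),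
    qc_quotient q1 -> qc_quotient q2 ->
    exists (N3 : kmodule) (q3 : forall S, M S -> N3 S),
      [/\ qc_quotient q3, factors_through q1 q3 & factors_through q2 q3].

Definition qlim_raw (M : kmodule) (S : comAlgType K) :=
  forall (N : kmodule), (forall S', M S' -> N S') -> N S.

Definition qlim_elt (M : kmodule) (S : comAlgType K) (x : qlim_raw M S) : Prop :=
  forall (N N' : kmodule) (q : forall S', M S' -> N S') (q' : forall S', M S' -> N' S')
         (f : forall S', N S' -> N' S'),
    qc_quotient q -> qc_quotient q' -> is_kmor f ->
    (forall S' y, f S' (q S' y) = q' S' y) ->
    f S (x N q) = x N' q'.

Definition qlim_iso (M : kmodule) : Prop :=
  forall S : comAlgType K,
    (forall m m' : M S,
       (forall (N : kmodule) (q : forall S', M S' -> N S'), qc_quotient q ->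
          q S m = q S m') -> m = m') /\
    (forall x : qlim_raw M S, qlim_elt x ->
       exists m : M S, forall (N : kmodule) (q : forall S', M S' -> N S'),
         qc_quotient q -> q S m = x N q).

Definition is_limit_of_qc_quotients (M : kmodule) : Prop :=
  [/\ qc_quotients_small M, qc_quotients_directed M & qlim_iso M].

End KModules.

(* Main.v *)
Require Import Defs.
From HB Require Import structures.
From mathcomp Require Import all_boot all_order all_algebra.
From mathcomp Require Import generic_quotient boolp classical_sets.

(* An element w of M^*(T) is the same as a morphism M -> T (x) -, via the
   algebras T (x) U.  The key property of M is that every linear form S -> K
   carries x in M(S) to a point m of M(K), compatibly with all morphisms M -> K
   ([linear_points]).  It forces the image of any morphism f from M to a
   quasi-coherent module to be quasi-coherent, generated by f(M(K)): over a field,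
   linear forms separate the points of N (x) S.  Hence quasi-coherent quotients are
   directed, are determined by their kernels on M(K), and every w in M^*(T) factors
   through one of them, which reduces both implications to quasi-coherent modules.

   If M is reflexive, m is found as an element of M^**(K).  If M is the limit, the
   point m exists by linearity of S |-> N (x) S, and its compatibility with
   morphisms that are natural only for algebra maps is obtained by passing through
   K (+) eps S -> S[eps] and K (+) eps S -> K[eps].  The same square-zero trick with
   S (+) eps N(S) shows that quasi-coherent modules are reflexive. *)

Set Implicit Arguments. Unset Strict Implicit. Unset Printing Implicit Defensive.
Import GRing.Theory.
Local Open Scope ring_scope.
Local Open Scope quotient_scope.

(** * Additive maps of abelian groups *)

Definition addm (V W : zmodType) (f : V -> W) := forall x y, f (x + y) = f x + f y.

Lemma addm0 (V W : zmodType) (f : V -> W) : addm f -> f 0 = 0.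
Proof. by move=> fD; apply: (addrI (f 0)); rewrite -fD !addr0. Qed.

Lemma addmN (V W : zmodType) (f : V -> W) : addm f -> forall x, f (- x) = - f x.
Proof.
by move=> fD x; apply: (addrI (f x)); rewrite -fD !subrr (addm0 fD).
Qed.

Lemma addmB (V W : zmodType) (f : V -> W) : addm f -> forall x y, f (x - y) = f x - f y.
Proof. by move=> fD x y; rewrite fD addmN. Qed.

Lemma addm_sum (V W : zmodType) (f : V -> W) : addm f ->
  forall (I : Type) (s : seq I) (F : I -> V), f (\sum_(i <- s) F i) = \sum_(i <- s) f (F i).
Proof.
move=> fD I s F; elim: s => [|i s IH]; first by rewrite !big_nil (addm0 fD).
by rewrite !big_cons fD IH.
Qed.

(** * Linear algebra over a field *)

Section LinearAlgebra.
Variables (K : fieldType) (V : lmodType K).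

Definition subsp (W : V -> Prop) :=
  [/\ W 0, forall x y, W x -> W y -> W (x + y) & forall (k : K) x, W x -> W (k *: x)].

Lemma subspB W x y : subsp W -> W x -> W y -> W (x - y).
Proof. by case=> _ WD WZ Wx Wy; rewrite -scaleN1r; apply: WD => //; apply: WZ. Qed.

(** A subspace maximal among those meeting [W] only in 0, given by Zorn's lemma, is a complement: a
    vector outside its sum with [W] could be adjoined to it. *)
Lemma ex_complement (W : V -> Prop) : subsp W ->
  exists C : V -> Prop, [/\ subsp C, forall x, C x -> W x -> x = 0 &
    forall x, exists c w, [/\ C c, W w & x = c + w]].
Proof.
move=> sW; have [W0 WD WZ] := sW.
(* The union of the empty chain is empty, so 0 is added to each set here instead of being required
   in it. *)
pose z (C : set V) x := x = 0 \/ C x.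
pose P (C : set V) := subsp (z C) /\ forall x, C x -> W x -> x = 0.
have [F FP Ftot|C [[sC CW] Cmax]] := @Zorn_bigcup V P.
  split; last by move=> x [A FA Ax]; exact: (FP _ FA).2.
  split; first by left.
    move=> x y [->|[A FA Ax]]; first by rewrite add0r.
    case=> [->|[B FB By]]; first by rewrite addr0; right; exists A.
    have [AB|BA] := Ftot _ _ FA FB.
      have [[_ BD _] _] := FP _ FB.
      case: (BD x y); [by right; apply: AB|by right|by left|by right; exists B].
    have [[_ AD _] _] := FP _ FA.
    case: (AD x y); [by right|by right; apply: BA|by left|by right; exists A].
  move=> k x [->|[A FA Ax]]; first by rewrite scaler0; left.
  have [[_ _ AZ] _] := FP _ FA.
  by case: (AZ k x); [right|left|right; exists A].
have [C0 CD CZ] := sC.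
exists (z C); split=> // [x [->//|Cx]|x]; first exact: CW.
apply: contrapT => nx.
pose C' : set V := fun y => exists c k, z C c /\ y = c + k *: x.
apply: (Cmax C').
  split=> [y Cy|le].
    by exists y, 0; rewrite scale0r addr0; split=> //; right.
  apply: nx; exists x, 0; split=> //; last by rewrite addr0.
  by right; apply: le; exists 0, 1; rewrite scale1r add0r; split=> //; left.
split.
  have zC' y : z C' y -> C' y.
    by case=> // ->; exists 0, 0; rewrite scale0r addr0; split=> //; left.
  split; first by left.
    move=> _ _ /zC'[c [k [Cc ->]]] /zC'[d [l [Cd ->]]]; right.
    by exists (c + d), (k + l); split; [exact: CD|rewrite scalerDl addrACA].
  move=> l _ /zC'[c [k [Cc ->]]]; right.
  by exists (l *: c), (l * k); split; [exact: CZ|rewrite scalerDr scalerA].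
(* If [c + k *: x] lies in [W] with [k] nonzero, solving for [x] decomposes it, against [nx]. *)
move=> _ [c [k [Cc ->]]] Wy.
have [k0|k0] := eqVneq k 0.
  move: Wy; rewrite k0 scale0r addr0; case: Cc => // Cc; exact: CW.
case: nx; exists (- k^-1 *: c), (k^-1 *: (c + k *: x)).
split; [exact: CZ|exact: WZ|].
by rewrite scalerDr scalerA mulVf // scale1r scaleNr addrA addNr add0r.
Qed.

Lemma ex_proj (W : V -> Prop) : subsp W ->
  exists p : V -> V, [/\ addm p, forall (k : K) x, p (k *: x) = k *: p x,
    forall x, W (p x) & forall x, W x -> p x = x].
Proof.
move=> sW; have [W0 WD WZ] := sW.
have [C [sC CW all]] := ex_complement sW; have [C0 CD CZ] := sC.
have /choice[p pP] : forall x, exists w, W w /\ C (x - w).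
  by move=> x; have [c [w [Cc Ww ->]]] := all x; exists w; rewrite addrK.
have puniq x w : W w -> C (x - w) -> p x = w.
  move=> Ww Cw; have [Wp Cp] := pP x.
  apply/eqP; rewrite -subr_eq0; apply/eqP; apply: CW; last exact: subspB.
  by have := subspB sC Cw Cp; rewrite opprB addrC addrA subrK.
exists p; split=> [x y|k x|x|x Wx]; last by apply: puniq; rewrite ?subrr.
- have [Wx Cx] := pP x; have [Wy Cy] := pP y.
  by apply: puniq; [exact: WD|rewrite opprD addrACA; exact: CD].
- have [Wx Cx] := pP x.
  by apply: puniq; [exact: WZ|rewrite -scalerBr; exact: CZ].
- exact: (pP x).1.
Qed.

Definition linform (f : V -> K) :=
  (forall x y, f (x + y) = f x + f y) /\ forall (k : K) x, f (k *: x) = k * f x.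

Lemma ex_functional (W : V -> Prop) (v : V) : subsp W -> ~ W v ->
  exists f : V -> K, [/\ linform f, forall x, W x -> f x = 0 & f v = 1].
Proof.
move=> sW Wv; have [p [pD pZ Wp pW]] := ex_proj sW.
(* [v'] is the component of [v] in the kernel of [p], nonzero since [v] is outside [W]; [f] will
   read the coordinate along [v'] after a second projection, onto the line of [v']. *)
pose v' := v - p v.
have v'0 : v' <> 0 by move=> /eqP; rewrite subr_eq0 => /eqP vE; apply: Wv; rewrite vE.
pose L x := exists k : K, x = k *: v'.
have sL : subsp L.
  split; first by exists 0; rewrite scale0r.
    by move=> _ _ [k ->] [l ->]; exists (k + l); rewrite scalerDl.
  by move=> l _ [k ->]; exists (l * k); rewrite scalerA.
have [p' [pD' pZ' Lp' pL']] := ex_proj sL.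
have /choice[f fP] x : exists k, p' (x - p x) = k *: v' by exact: Lp'.
have funiq x k : p' (x - p x) = k *: v' -> f x = k.
  rewrite fP => /eqP; rewrite -subr_eq0 -scalerBl scaler_eq0 subr_eq0.
  by case/orP=> /eqP.
exists f; split=> [|x Wx|].
- split=> [x y|k x]; apply: funiq.
    by rewrite pD opprD addrACA pD' !fP scalerDl.
  by rewrite pZ -scalerBr pZ' fP scalerA.
- by apply: funiq; rewrite pW // subrr scale0r (addm0 pD').
- by apply: funiq; rewrite pL' ?scale1r //; exists 1; rewrite scale1r.
Qed.

End LinearAlgebra.

(** * Tensor products *)

Section Tensor.
Variables (K : fieldType) (V A : lmodType K).

Definition balanced (W : zmodType) (B : V -> A -> W) :=
  [/\ forall v v' a, B (v + v') a = B v a + B v' a,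
      forall v a a', B v (a + a') = B v a + B v a' &
      forall (k : K) v a, B (k *: v) a = B v (k *: a)].

Definition teval (W : zmodType) (B : V -> A -> W) (s : seq (V * A)) : W :=
  \sum_(p <- s) B p.1 p.2.

(* Two formal sums of pure tensors are identified when no balanced map into an
   abelian group separates them; this is the tensor product, and its universal
   property holds by construction. *)
Definition teq (s t : seq (V * A)) : bool :=
  `[< forall (W : zmodType) (B : V -> A -> W), balanced B -> teval B s = teval B t >].

Lemma teq_refl : reflexive teq. Proof. by move=> s; apply/asboolP. Qed.
Lemma teq_sym : symmetric teq.
Proof. by move=> s t; apply/asboolP/asboolP => h W B bB; rewrite h. Qed.
Lemma teq_trans : transitive teq.
Proof.
move=> s t u /asboolP h1 /asboolP h2; apply/asboolP => W B bB.
by rewrite h1 // h2.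
Qed.

Canonical teq_equiv := EquivRel teq teq_refl teq_sym teq_trans.

Definition tens : Type := {eq_quot teq_equiv}%qT.
HB.instance Definition _ := Choice.on tens.

Definition tpi (s : seq (V * A)) : tens := (\pi_{eq_quot teq_equiv} s)%qT.
Definition trepr (x : tens) : seq (V * A) := @repr _ {eq_quot teq_equiv} x.
Definition tlift (W : zmodType) (B : V -> A -> W) (x : tens) := teval B (trepr x).

Lemma tlift_pi (W : zmodType) (B : V -> A -> W) s : balanced B -> tlift B (tpi s) = teval B s.
Proof.
move=> bB; have /asboolP h : teq (trepr (tpi s)) s.
  by apply/(@eqquotP _ teq_equiv {eq_quot teq_equiv}); rewrite reprK.
exact: h.
Qed.

(** Balanced maps separate tensors by construction; the group laws are all checked after an
    arbitrary [tlift B]. *)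
Lemma tens_ext x y :
  (forall (W : zmodType) (B : V -> A -> W), balanced B -> tlift B x = tlift B y) -> x = y.
Proof.
move=> h; rewrite -[x](@reprK _ {eq_quot teq_equiv}) -[y](@reprK _ {eq_quot teq_equiv}).
by apply/(@eqquotP _ teq_equiv {eq_quot teq_equiv})/asboolP.
Qed.

Definition tadd x y := tpi (trepr x ++ trepr y).
Definition topp x := tpi [seq (- p.1, p.2) | p <- trepr x].
Definition pure v a := tpi [:: (v, a)].

Section LiftOps.
Variables (W : zmodType) (B : V -> A -> W).
Hypothesis bB : balanced B.

Lemma tlift_add x y : tlift B (tadd x y) = tlift B x + tlift B y.
Proof. by rewrite tlift_pi // /teval big_cat. Qed.

Lemma balNl v a : B (- v) a = - B v a.
Proof. by case: bB => h _ _; apply: (@addmN V W (B^~ a)) => ? ?; apply: h. Qed.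

Lemma tlift_opp x : tlift B (topp x) = - tlift B x.
Proof.
rewrite tlift_pi // /tlift /teval big_map -sumrN.
by apply: eq_bigr => p _; rewrite balNl.
Qed.

Lemma tlift_nil : tlift B (tpi [::]) = 0.
Proof. by rewrite tlift_pi // /teval big_nil. Qed.

Lemma tlift_pure v a : tlift B (pure v a) = B v a.
Proof. by rewrite tlift_pi // /teval big_seq1. Qed.
End LiftOps.

Lemma taddA : associative tadd.
Proof. by move=> x y z; apply: tens_ext => W B bB; rewrite !tlift_add // addrA. Qed.
Lemma taddC : commutative tadd.
Proof. by move=> x y; apply: tens_ext => W B bB; rewrite !tlift_add // addrC. Qed.
Lemma tadd0 : left_id (tpi [::]) tadd.
Proof. by move=> x; apply: tens_ext => W B bB; rewrite tlift_add // tlift_nil // add0r. Qed.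
Lemma taddN : left_inverse (tpi [::]) topp tadd.
Proof.
move=> x; apply: tens_ext => W B bB.
by rewrite tlift_add // tlift_opp // tlift_nil // addNr.
Qed.

HB.instance Definition _ := GRing.isZmodule.Build tens taddA taddC tadd0 taddN.

Lemma tliftD (W : zmodType) (B : V -> A -> W) : balanced B -> addm (tlift B).
Proof. by move=> bB x y; rewrite -tlift_add. Qed.

Lemma pureDl v v' a : pure (v + v') a = pure v a + pure v' a.
Proof.
apply: tens_ext => W B bB; rewrite tliftD // !tlift_pure //.
by case: bB => ->.
Qed.
Lemma pureDr v a a' : pure v (a + a') = pure v a + pure v a'.
Proof.
apply: tens_ext => W B bB; rewrite tliftD // !tlift_pure //.
by case: bB => _ ->.
Qed.
Lemma pureZ (k : K) v a : pure (k *: v) a = pure v (k *: a).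
Proof.
apply: tens_ext => W B bB; rewrite !tlift_pure //.
by case: bB => _ _ ->.
Qed.

Lemma tens_gen x : exists s : seq (V * A), x = \sum_(p <- s) pure p.1 p.2.
Proof.
exists (trepr x); apply: tens_ext => W B bB.
rewrite (addm_sum (tliftD bB)); apply: eq_bigr => p _.
by rewrite tlift_pure.
Qed.

Lemma tens_addm_ext (W : zmodType) (f g : tens -> W) :
  addm f -> addm g -> (forall v a, f (pure v a) = g (pure v a)) -> f =1 g.
Proof.
move=> fD gD fg x; have [s ->] := tens_gen x.
by rewrite !addm_sum //; apply: eq_bigr => p _; rewrite fg.
Qed.

(** Linear forms with value 1 at [v] and at [a] multiply to a balanced map with value 1 at the pure
    tensor. This makes 1 nonzero in [talg]. *)
Lemma pure_neq0 v a : v != 0 -> a != 0 -> pure v a != 0.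
Proof.
have s0 (U : lmodType K) : subsp (fun x : U => x = 0).
  by split=> // [x y -> ->|k x ->]; rewrite ?addr0 ?scaler0.
move=> /eqP v0 /eqP a0.
have [f [[fD fZ] _ fv]] := ex_functional (s0 V) v0.
have [g [[gD gZ] _ ga]] := ex_functional (s0 A) a0.
have bB : balanced (fun v a => f v * g a).
  by split=> *; rewrite ?fD ?gD ?fZ ?gZ ?mulrDl ?mulrDr // mulrCA mulrA.
apply/eqP => e0.
have := tlift_pure bB v a; rewrite e0 (addm0 (tliftD bB)) fv ga mulr1.
by move/eqP; rewrite eq_sym oner_eq0.
Qed.

End Tensor.
Arguments pure {K V A} v a.

Section TensorScale.
Variables (K : fieldType) (V : lmodType K) (A : comAlgType K).
Local Notation T := (tens V A).

Lemma bal_scale (a : A) : balanced (fun (v : V) (b : A) => pure v (a * b) : T).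
Proof.
split=> [v v' b|v b b'|k v b]; first by rewrite pureDl.
  by rewrite mulrDr pureDr.
by rewrite pureZ scalerAr.
Qed.

Definition tscale (a : A) : T -> T := tlift (fun v b => pure v (a * b)).

Lemma tscale_add a : addm (tscale a). Proof. exact: tliftD (bal_scale a). Qed.
Lemma tscale_pure a v b : tscale a (pure v b) = pure v (a * b).
Proof. exact: tlift_pure (bal_scale a) _ _. Qed.

Lemma tscaleA a b x : tscale a (tscale b x) = tscale (a * b) x.
Proof.
apply: (@tens_addm_ext _ _ _ _ (fun x => tscale a (tscale b x))) x => [x y||v c].
- by rewrite !tscale_add.
- exact: tscale_add.
- by rewrite !tscale_pure mulrA.
Qed.
Lemma tscale1 : left_id 1 tscale.
Proof.
apply: tens_addm_ext => [||v c]; [exact: tscale_add|by []|].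
by rewrite tscale_pure mul1r.
Qed.
Lemma tscaleDr : right_distributive tscale +%R.
Proof. by move=> a; exact: tscale_add. Qed.
Lemma tscaleDl x : {morph tscale^~ x : a b / a + b}.
Proof.
move=> a b.
apply: (@tens_addm_ext _ _ _ _ (tscale (a + b)) (fun x => tscale a x + tscale b x)) => [|y z|v c].
- exact: tscale_add.
- by rewrite !tscale_add addrACA.
- by rewrite !tscale_pure mulrDl pureDr.
Qed.

HB.instance Definition _ :=
  GRing.Zmodule_isLmodule.Build A T tscaleA tscale1 tscaleDr tscaleDl.

Lemma scale_pure (a : A) (v : V) (b : A) : a *: (pure v b : T) = pure v (a * b).
Proof. exact: tscale_pure. Qed.

End TensorScale.

(** * The tensor product of two algebras *)

Section TensorAlgebra.
Variables (K : fieldType) (A B : comAlgType K).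

(** A separate copy of [tens A B], so that its scalars can be K, whereas [tens] is a module over its
    second factor. *)
Definition talg : Type := tens A B.
HB.instance Definition _ := GRing.Zmodule.on talg.

Lemma bal_mul1 (a : A) (b : B) :
  balanced (fun (a' : A) (b' : B) => pure (a * a') (b * b') : talg).
Proof.
split=> [v v' c|v c c'|k v c]; first by rewrite mulrDr pureDl.
  by rewrite mulrDr pureDr.
by rewrite -!scalerAr pureZ.
Qed.

Definition tmul1 a b : talg -> talg := tlift (fun a' b' => pure (a * a') (b * b')).

Lemma tmul1D a b : addm (tmul1 a b). Proof. exact: tliftD (bal_mul1 a b). Qed.
Lemma tmul1_pure a b a' b' : tmul1 a b (pure a' b') = pure (a * a') (b * b').
Proof. exact: tlift_pure (bal_mul1 a b) _ _. Qed.

Lemma bal_mul (y : talg) : balanced (fun (a : A) (b : B) => tmul1 a b y).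
Proof.
have D a b := tmul1D a b.
split=> [a a' b|a b b'|k a b].
- apply: (@tens_addm_ext _ _ _ _ (tmul1 (a + a') b) (fun y => tmul1 a b y + tmul1 a' b y))
  => [|u w|v c] //.
    by rewrite !D addrACA.
  by rewrite !tmul1_pure mulrDl pureDl.
- apply: (@tens_addm_ext _ _ _ _ (tmul1 a (b + b')) (fun y => tmul1 a b y + tmul1 a b' y))
  => [|u w|v c] //.
    by rewrite !D addrACA.
  by rewrite !tmul1_pure mulrDl pureDr.
- apply: tens_addm_ext y => // v c.
  by rewrite !tmul1_pure -!scalerAl pureZ.
Qed.

Definition tmul (x y : talg) : talg := tlift (fun a b => tmul1 a b y) x.

Lemma tmulDl : left_distributive tmul +%R.
Proof. by move=> x y z; exact: tliftD (bal_mul z) _ _. Qed.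
Lemma tmul_purel a b y : tmul (pure a b) y = tmul1 a b y.
Proof. exact: tlift_pure (bal_mul y) _ _. Qed.
Lemma tmulDr : right_distributive tmul +%R.
Proof.
move=> x y z.
apply: (@tens_addm_ext _ _ _ _ (tmul^~ (y + z)) (fun x => tmul x y + tmul x z)) => [u w|u w|a b].
- by rewrite tmulDl.
- by rewrite !tmulDl addrACA.
- by rewrite !tmul_purel tmul1D.
Qed.
Lemma tmul_pure a b a' b' : tmul (pure a b) (pure a' b') = pure (a * a') (b * b').
Proof. by rewrite tmul_purel tmul1_pure. Qed.

Lemma tmulC : commutative tmul.
Proof.
move=> x y; apply: (@tens_addm_ext _ _ _ _ (tmul^~ y) (tmul y)) => [u w|u w|a b].
- by rewrite tmulDl.
- by rewrite tmulDr.
apply: (@tens_addm_ext _ _ _ _ (tmul (pure a b)) (tmul^~ (pure a b))) => [u w|u w|a' b'].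
- by rewrite tmulDr.
- by rewrite tmulDl.
by rewrite !tmul_pure mulrC (mulrC b).
Qed.

Lemma tmulA : associative tmul.
Proof.
move=> x y z.
apply: (@tens_addm_ext _ _ _ _ (fun x => tmul x (tmul y z)) (fun x => tmul (tmul x y) z))
  => [u w|u w|a b].
- by rewrite tmulDl.
- by rewrite !tmulDl.
apply: (@tens_addm_ext _ _ _ _ (fun y => tmul _ (tmul y z)) (fun y => tmul (tmul _ y) z))
  => [u w|u w|a' b'].
- by rewrite tmulDl tmulDr.
- by rewrite tmulDr tmulDl.
apply: (@tens_addm_ext _ _ _ _ (fun z => tmul _ (tmul _ z)) (fun z => tmul (tmul _ _) z))
  => [u w|u w|a2 b2].
- by rewrite !tmulDr.
- by rewrite !tmulDr.
by rewrite !tmul_pure !mulrA.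
Qed.

Lemma tmul1r : left_id (pure 1 1) tmul.
Proof.
apply: tens_addm_ext => [u w|//|a b]; first by rewrite tmulDr.
by rewrite tmul_pure !mul1r.
Qed.

Lemma tone_neq0 : (pure 1 1 : talg) != 0.
Proof. by rewrite pure_neq0 ?oner_neq0. Qed.

HB.instance Definition _ :=
  GRing.Zmodule_isComNzRing.Build talg tmulA tmulC tmul1r tmulDl tone_neq0.

Definition tpure (a : A) (b : B) : talg := pure a b.

Lemma tpureM a b a' b' : tpure a b * tpure a' b' = tpure (a * a') (b * b').
Proof. exact: tmul_pure. Qed.
Lemma tpureDl a a' b : tpure (a + a') b = tpure a b + tpure a' b.
Proof. exact: pureDl. Qed.
Lemma tpureDr a b b' : tpure a (b + b') = tpure a b + tpure a b'.
Proof. exact: pureDr. Qed.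

Definition tkscale (k : K) (x : talg) : talg := tmul1 1 k%:A x.

Lemma tkscaleE k x : tkscale k x = tpure 1 k%:A * x.
Proof. exact: esym (tmul_purel _ _ _). Qed.

Lemma tkscaleA a b x : tkscale a (tkscale b x) = tkscale (a * b) x.
Proof. by rewrite !tkscaleE mulrA tpureM mul1r -scalerAl mul1r scalerA. Qed.
Lemma tkscale1 : left_id 1 tkscale.
Proof. by move=> x; rewrite tkscaleE scale1r mul1r. Qed.
Lemma tkscaleDr : right_distributive tkscale +%R.
Proof. by move=> k x y; rewrite !tkscaleE mulrDr. Qed.
Lemma tkscaleDl x : {morph tkscale^~ x : a b / a + b}.
Proof. by move=> k l; rewrite !tkscaleE scalerDl tpureDr mulrDl. Qed.
HB.instance Definition _ :=
  GRing.Zmodule_isLmodule.Build K talg tkscaleA tkscale1 tkscaleDr tkscaleDl.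

Lemma tkscaleAl (k : K) (x y : talg) : k *: (x * y) = (k *: x) * y.
Proof. by rewrite /GRing.scale /= !tkscaleE mulrA. Qed.
HB.instance Definition _ := GRing.Lmodule_isLalgebra.Build K talg tkscaleAl.
HB.instance Definition _ := GRing.Lalgebra_isComAlgebra.Build K talg.

Lemma tpure1 : tpure 1 1 = 1. Proof. by []. Qed.
Lemma tpureZr (k : K) a b : k *: tpure a b = tpure a (k *: b).
Proof. by rewrite /GRing.scale /= tkscaleE tpureM mul1r -scalerAl mul1r. Qed.
Lemma tpureZl (k : K) a b : k *: tpure a b = tpure (k *: a) b.
Proof. by rewrite tpureZr; exact: esym (pureZ _ _ _). Qed.
Lemma talg_ext (W : zmodType) (f g : talg -> W) :
  addm f -> addm g -> (forall v a, f (tpure v a) = g (tpure v a)) -> f =1 g.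
Proof. exact: tens_addm_ext. Qed.

Lemma tpure_inl : kalg_hom (fun a => tpure a 1).
Proof.
split=> [x y|x y||k x]; [exact: tpureDl| |by []|by rewrite tpureZl].
by rewrite tpureM mulr1.
Qed.
Lemma tpure_inr : kalg_hom (tpure 1).
Proof.
split=> [x y|x y||k x]; [exact: tpureDr| |by []|by rewrite tpureZr].
by rewrite tpureM mulr1.
Qed.

End TensorAlgebra.

(** * Functorial modules and quasi-coherence *)

Section Homs.
Variable K : fieldType.

Lemma kalg_hom_id (S : comAlgType K) : kalg_hom (fun s : S => s).
Proof. by []. Qed.

Lemma kalg_hom_comp (S T U : comAlgType K) (f : S -> T) (g : T -> U) :
  kalg_hom f -> kalg_hom g -> kalg_hom (fun s => g (f s)).
Proof.
move=> [fD fM f1 fZ] [gD gM g1 gZ].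
by split=> [x y|x y||k x]; rewrite ?fD ?gD ?fM ?gM ?f1 ?g1 ?fZ ?gZ.
Qed.

Lemma kstr_hom (S : comAlgType K) : kalg_hom (@kstr K S).
Proof.
split=> [x y|x y||k x]; rewrite /kstr.
- by rewrite scalerDl.
- by rewrite -scalerAl mul1r scalerA.
- by rewrite scale1r.
- by rewrite scalerA.
Qed.

Lemma kalg_hom_kstr (S : comAlgType K) (f : K^o -> S) : kalg_hom f -> f = @kstr K S.
Proof.
move=> [_ _ f1 fZ]; apply: funext => k.
by rewrite /kstr -f1 -fZ; congr f; rewrite /GRing.scale /= mulr1.
Qed.

Lemma kstr_comp (S T : comAlgType K) (f : S -> T) : kalg_hom f ->
  (fun k => f (@kstr K S k)) = @kstr K T.
Proof. by move=> fh; apply: kalg_hom_kstr; apply: kalg_hom_comp fh; exact: kstr_hom. Qed.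

Lemma kstr_id : @kstr K K^o = id.
Proof. by symmetry; apply: kalg_hom_kstr; apply: kalg_hom_id. Qed.

Section KMor.
Variables (M N : kmodule K) (eta : forall S, M S -> N S).
Hypothesis etah : is_kmor eta.

Lemma kmorD (S : comAlgType K) : addm (eta (S:=S)).
Proof. by case: etah => h _ _; apply: h. Qed.
Lemma kmorZ (S : comAlgType K) (s : S) x : eta (s *: x) = s *: eta x.
Proof. by case: etah => _ h _; apply: h. Qed.
Lemma kmor_map (S T : comAlgType K) (f : S -> T) : kalg_hom f ->
  forall x, eta (kmap f x) = kmap f (eta x).
Proof. by case: etah => _ _; apply. Qed.
Lemma kmor0 (S : comAlgType K) : eta (0 : M S) = 0. Proof. exact: addm0 (@kmorD S). Qed.
Lemma kmorB (S : comAlgType K) (x y : M S) : eta (x - y) = eta x - eta y.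
Proof. exact: addmB (@kmorD S) _ _. Qed.
End KMor.

Lemma is_kmor_comp (M N P : kmodule K) (f : forall S, M S -> N S) (g : forall S, N S -> P S) :
  is_kmor f -> is_kmor g -> is_kmor (fun S x => g S (f S x)).
Proof.
move=> [fD fZ fm] [gD gZ gm].
split=> [S x y|S s x|S T h hh x]; first by rewrite fD gD.
  by rewrite fZ gZ.
by rewrite fm // gm.
Qed.

Lemma is_kmor_add (M N : kmodule K) (f g : forall S, M S -> N S) :
  is_kmor f -> is_kmor g -> is_kmor (fun S x => f S x + g S x).
Proof.
move=> [fD fZ fm] [gD gZ gm].
split=> [S x y|S s x|S T h hh x]; first by rewrite fD gD addrACA.
  by rewrite fZ gZ scalerDr.
by rewrite fm // gm // kmap_add.
Qed.

(** A morphism from [M] to this functor S |-> S is a linear form on [M], that is, an element of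
    M^*(K). *)
Definition kone : kmodule K.
Proof.
refine (@KModule K (fun S => S^o : lmodType S) (fun S T f => f) _ _ _ _) => //.
- by move=> S T f [].
- by move=> S T f [_ fM _ _] s x; rewrite [LHS]fM.
Defined.

(** For quasi-coherent [N] this is n |-> n (x) 1, so [s *: ins S n] stands for the pure tensor n (x)
    s. *)
Definition ins (N : kmodule K) (S : comAlgType K) (n : N K^o) : N S := kmap (@kstr K S) n.

Lemma insD (N : kmodule K) (S : comAlgType K) : addm (@ins N S).
Proof. by move=> x y; apply/kmap_add/kstr_hom. Qed.
Lemma insZ (N : kmodule K) (S : comAlgType K) (k : K) (x : N K^o) :
  ins S ((k : K^o) *: x) = kstr S k *: ins S x.
Proof. by apply/kmap_scale/kstr_hom. Qed.
Lemma ins_map (N : kmodule K) (S T : comAlgType K) (f : S -> T) : kalg_hom f ->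
  forall n : N K^o, kmap f (ins S n) = ins T n.
Proof. by move=> fh n; rewrite /ins -kmap_comp ?kstr_comp //; exact: kstr_hom. Qed.
Lemma ins_id (N : kmodule K) (n : N K^o) : ins K^o n = n.
Proof. by rewrite /ins kstr_id kmap_id. Qed.
Lemma kmor_ins (M N : kmodule K) (eta : forall S, M S -> N S) : is_kmor eta ->
  forall S (m : M K^o), eta S (ins S m) = ins S (eta K^o m).
Proof. by move=> h S m; rewrite /ins (kmor_map h) //; exact: kstr_hom. Qed.

End Homs.
Arguments ins {K N} S n.

(** * Quasi-coherent modules as tensor products *)

Section QuasiCoherent.
Variables (K : fieldType) (N : kmodule K).
Hypothesis Nqc : quasi_coherent N.

Lemma bal_act (S : comAlgType K) :
  balanced (fun (n : (N K^o : lmodType K)) (s : S) => s *: ins S n).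
Proof.
split=> [n n' s|n s s'|k n s]; first by rewrite insD scalerDr.
  by rewrite scalerDl.
by rewrite [ins S _]insZ scalerA /kstr -scalerAr mulr1.
Qed.

Let V := (N K^o : lmodType K).

Lemma qc_tens (S : comAlgType K) : exists h : N S -> tens V S,
  [/\ addm h, forall (s : S) x, h (s *: x) = s *: h x &
      forall n, h (ins S n) = pure (n : V) (1 : S)].
Proof.
have [|k n|h [hD hZ hi _]] := Nqc (V := tens V S) (g := fun n => pure (n : V) 1); last by exists h.
  by move=> x y; exact: pureDl.
by rewrite [LHS](@pureZ _ V S) scale_pure mulr1.
Qed.

(** Going from N(S) to N(K) (x) S and back is S-linear and fixes every [ins S n], so it is the
    identity by the uniqueness in the universal property; its values are visibly such sums. *)
Lemma qc_gen (S : comAlgType K) (y : N S) :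
  exists s : seq (N K^o * S), y = \sum_(p <- s) p.2 *: ins S p.1.
Proof.
have [h [hD hZ hi]] := qc_tens S.
have [||h0 [_ _ _ h0u]] := Nqc (V := N S) (g := ins S).
- exact: insD.
- exact: insZ.
have yE : y = tlift (fun (n : V) (s : S) => s *: ins S n) (h y).
  have ph z : tlift (fun (n : V) (s : S) => s *: ins S n) (h z) = h0 z.
    apply: (h0u (fun z => tlift (fun (n : V) (s : S) => s *: ins S n) (h z))).
    - by move=> x x'; rewrite hD tliftD //; exact: bal_act.
    - move=> s x; rewrite hZ; have [t ->] := tens_gen (h x).
      rewrite scaler_sumr !(addm_sum (tliftD (bal_act S))) scaler_sumr.
      apply: eq_bigr => p _.
      by rewrite scale_pure !tlift_pure ?scalerA //; exact: bal_act.
    - by move=> n; rewrite hi tlift_pure ?scale1r //; exact: bal_act.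
  by rewrite ph; apply: (h0u id).
by exists (trepr (h y)); rewrite {1}yE.
Qed.

Lemma qc_ext (S : comAlgType K) (W : zmodType) (f g : N S -> W) : addm f -> addm g ->
  (forall s n, f (s *: ins S n) = g (s *: ins S n)) -> f =1 g.
Proof.
move=> fD gD fg y; have [s ->] := qc_gen y.
by rewrite !addm_sum //; apply: eq_bigr => p _; rewrite fg.
Qed.

(** The universal property of [quasi_coherent] yields S-linear maps only; passing through the tensor
    product yields maps that are merely additive. *)
Lemma qc_lift (S : comAlgType K) (W : zmodType) (B : V -> S -> W) : balanced B ->
  exists b : N S -> W, addm b /\ forall s n, b (s *: ins S n) = B n s.
Proof.
move=> bB; have [h [hD hZ hi]] := qc_tens S.
exists (fun y => tlift B (h y)); split=> [x y|s n]; first by rewrite hD tliftD.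
by rewrite hZ hi scale_pure mulr1 tlift_pure.
Qed.

Definition klin (S T : lmodType K) (l : S -> T) :=
  addm l /\ forall (k : K) x, l (k *: x) = k *: l x.

(** This is id (x) l: a quasi-coherent module is functorial in K-linear maps, not only in algebra
    morphisms. *)
Lemma qc_basechange (S T : comAlgType K) (l : S -> T) : klin l ->
  exists b : N S -> N T, addm b /\ forall s n, b (s *: ins S n) = l s *: ins T n.
Proof.
move=> [lD lZ]; apply: (qc_lift (B := fun (n : V) s => l s *: ins T n)).
split=> [n n' s|n s s'|k n s]; first by rewrite insD scalerDr.
  by rewrite lD scalerDl.
by rewrite [ins T _]insZ scalerA lZ /kstr -scalerAr mulr1.
Qed.

(** Each component comes from the universal property at [S]; naturality holds because both sides
    agree on the generators [s *: ins S n]. *)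
Lemma qc_ext_kmor (N' : kmodule K) (theta : N K^o -> N' K^o) :
  addm theta -> (forall (k : K) x, theta ((k : K^o) *: x) = (k : K^o) *: theta x) ->
  exists eta : forall S, N S -> N' S, is_kmor eta /\ forall n, eta K^o n = theta n.
Proof.
move=> tD tZ.
have H S : exists h : N S -> N' S, [/\ addm h, forall (s : S) x, h (s *: x) = s *: h x &
    forall n, h (ins S n) = ins S (theta n)].
  have [||h [hD hZ hi _]] := Nqc (V := N' S) (g := fun n => ins S (theta n)); last by exists h.
    by move=> x y; rewrite tD insD.
  by move=> k x; rewrite tZ insZ.
pose eta S := sval (cid (H S)).
have eP S : [/\ addm (eta S), forall (s : S) x, eta S (s *: x) = s *: eta S x &
    forall n, eta S (ins S n) = ins S (theta n)] by exact: svalP (cid (H S)).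
exists eta; split; last by move=> n; have [_ _ h] := eP K^o; rewrite -{1}(ins_id n) h ins_id.
split=> [S|S|S T f fh]; try by case: (eP S).
have [eDS eZS eiS] := eP S; have [eDT eZT eiT] := eP T.
apply: qc_ext => [x y|x y|s n].
- by rewrite kmap_add // eDT.
- by rewrite eDS kmap_add.
- by rewrite kmap_scale // eZT eZS kmap_scale // !ins_map // eiT eiS ins_map.
Qed.

Lemma qc_form (f : V -> K) : linform f ->
  exists nu : forall S, N S -> kone K S, is_kmor nu /\ forall n, nu K^o n = f n.
Proof. by move=> [fD fZ]; apply: qc_ext_kmor. Qed.

Section Separation.
Variables (N0 : V -> Prop) (N0s : subsp N0) (S : comAlgType K).

(** The image of N0 (x) S in N(S). *)
Definition inspan (y : N S) := exists s : seq (V * S),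
  (forall p, p \in s -> N0 p.1) /\ y = \sum_(p <- s) p.2 *: ins S p.1.

Lemma inspanD y y' : inspan y -> inspan y' -> inspan (y + y').
Proof.
move=> [s [sN ->]] [t [tN ->]]; exists (s ++ t); rewrite big_cat; split=> // p.
by rewrite mem_cat => /orP[/sN|/tN].
Qed.

Lemma inspan1 s n : N0 n -> inspan (s *: ins S n).
Proof.
move=> Nn; exists [:: (n, s)]; rewrite big_seq1; split=> // p.
by rewrite inE => /eqP ->.
Qed.

(** The sum of [N0] and the K-span of the first components of [s]. *)
Fixpoint spn (s : seq (V * S)) (x : V) : Prop :=
  if s is p :: s' then exists (k : K) x', spn s' x' /\ x = x' + k *: p.1 else N0 x.

Lemma spn_sub s : subsp (spn s).
Proof.
elim: s => [//|p s [s0 sD sZ]] /=; split.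
- by exists 0, 0; rewrite scale0r addr0.
- move=> _ _ [k [x [sx ->]]] [l [y [sy ->]]]; exists (k + l), (x + y).
  by split; [exact: sD|rewrite scalerDl addrACA].
- move=> c _ [k [x [sx ->]]]; exists (c * k), (c *: x).
  by split; [exact: sZ|rewrite scalerDr scalerA].
Qed.

Lemma spn0 s x : N0 x -> spn s x.
Proof.
by elim: s => [//|p s IH] Nx /=; exists 0, x; rewrite scale0r addr0; split=> //; apply: IH.
Qed.

Lemma spn_mem s p : p \in s -> spn s p.1.
Proof.
elim: s => [//|q s IH]; rewrite inE => /orP[/eqP->|/IH sp] /=.
  by exists 1, 0; rewrite scale1r add0r; split=> //; case: (spn_sub s).
by exists 0, p.1; rewrite scale0r addr0.
Qed.

(** Expanding [x] over [N0] and the vectors of [s] moves x (x) c into the coefficients of [s] and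
    one term of N0 (x) S. The length is unchanged, which lets [qc_sep] drop a dependent vector. *)
Lemma spn_absorb s x : spn s x -> forall c : S, exists t n0, [/\ size t = size s, N0 n0 &
  c *: ins S x + \sum_(p <- s) p.2 *: ins S p.1 =
  c *: ins S n0 + \sum_(p <- t) p.2 *: ins S p.1].
Proof.
elim: s x => [|q s IH] x /= sx c; first by exists [::], x.
case: sx => k [x' [/IH/(_ c)[t [n0 [szt Nn e]]] ->]].
exists ((q.1, c * k%:A + q.2) :: t), n0; rewrite /= szt; split=> //.
rewrite !big_cons /= insD [ins S (k *: _)]insZ scalerDr scalerA /kstr.
rewrite scalerDl [in RHS]addrA [in RHS](addrC (c *: _)) -[in RHS]addrA -e.
by rewrite (addrC (c *: _)) addrACA.
Qed.

(** Modulo N0 (x) S, [y] is a sum that is shortened term by term. A leading vector dependent on [N0]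
    and the others is absorbed by them; otherwise some linear form isolates its coefficient, which
    is then 0. *)
Lemma qc_sep (y : N S) :
  (forall nu : forall U, N U -> kone K U, is_kmor nu ->
     (forall n, N0 n -> nu K^o n = 0) -> nu S y = 0) -> inspan y.
Proof.
move=> H; suff red s : inspan (y - \sum_(p <- s) p.2 *: ins S p.1) -> inspan y.
  have [s ys] := qc_gen y; apply: (red s); rewrite -ys subrr.
  by exists [::]; rewrite big_nil.
move: {2}(size s) (leqnn (size s)) => m; elim: m s => [|m IH] [|p s] //=;
  try by rewrite big_nil subr0.
rewrite ltnS => szs; rewrite big_cons => Sy.
have [sp|nsp] := lem (spn s p.1).
  have [t [n0 [szt Nn e]]] := spn_absorb sp p.2.
  apply: (IH t); first by rewrite szt.
  rewrite (_ : y - _ = y - (p.2 *: ins S p.1 + \sum_(p <- s) p.2 *: ins S p.1) + p.2 *: ins S n0).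
    by apply: inspanD Sy _; apply: inspan1.
  by rewrite e opprD addrA addrAC subrK.
have [f [fl fs fp]] := ex_functional (spn_sub s) nsp.
have [nu [nuh nuE]] := qc_form fl.
have nui n : nu S (ins S n) = (f n)%:A by rewrite kmor_ins // nuE.
have nu0 n : spn s n -> nu S (ins S n) = 0 by move=> sn; rewrite nui fs // scale0r.
have nusp z : inspan z -> nu S z = 0.
  case=> t [tN ->]; rewrite (addm_sum (kmorD nuh (S:=S))) big_seq big1 // => q qt.
  by rewrite (kmorZ nuh) nu0 ?scaler0 //; apply/spn0/tN.
(* [nu] kills [y], the span of [N0] and the tail of the sum, so on the difference only [- p.2]
   remains. *)
have p20 : p.2 = 0.
  have := nusp _ Sy; rewrite kmorB // H // => [|n Nn]; last by rewrite nuE fs //; apply: spn0.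
  rewrite sub0r (kmorD nuh) (kmorZ nuh) nui fp.
  rewrite (addm_sum (kmorD nuh (S:=S))) big_seq big1 => [|q qs].
    rewrite addr0 => /eqP; rewrite oppr_eq0 => /eqP.
    by rewrite scale1r => e; rewrite -[p.2]mulr1; exact: e.
  by rewrite (kmorZ nuh) nu0 ?scaler0 //; apply: spn_mem.
by apply: (IH s) => //; move: Sy; rewrite p20 scale0r add0r.
Qed.

End Separation.

(** The case of the zero subspace in [qc_sep], applied to [y - y']. *)
Lemma qc_sep0 (S : comAlgType K) (y y' : N S) :
  (forall nu : forall U, N U -> kone K U, is_kmor nu -> nu S y = nu S y') -> y = y'.
Proof.
move=> H; apply/eqP; rewrite -subr_eq0; apply/eqP.
have [|nu nuh _|s [s0 ->]] := @qc_sep (fun x : V => x = 0) _ S (y - y').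
- by split=> // [x x' -> ->|k x ->]; rewrite ?addr0 ?scaler0.
- by rewrite kmorB // H // subrr.
- rewrite big_seq big1 // => p /s0 ->.
  by rewrite (addm0 (@insD K N S)) scaler0.
Qed.

End QuasiCoherent.

(** * Images, sums and tensor modules *)

Section Submodule.
Variables (R : pzRingType) (V : lmodType R) (P : V -> Prop).

Definition lclosed :=
  [/\ P 0, forall x y, P x -> P y -> P (x + y) & forall (r : R) x, P x -> P (r *: x)].

Hypothesis Pcl : lclosed.

(** The closure proof is an argument so that the closure instance can be attached to the predicate
    itself. *)
Definition submod_pred of lclosed : {pred V} := fun x => `[< P x >].

Lemma submod_predP x : reflect (P x) (x \in submod_pred Pcl).
Proof. exact: asboolP. Qed.

Lemma submod_pred_closed : subsemimod_closed (submod_pred Pcl).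
Proof.
have [P0 PD PZ] := Pcl; split.
  split=> [|x y /submod_predP Px /submod_predP Py]; apply/submod_predP; [exact: P0|exact: PD].
by move=> r x /submod_predP Px; apply/submod_predP/PZ.
Qed.
End Submodule.

HB.instance Definition _ (R : pzRingType) (V : lmodType R) (P : V -> Prop) (h : lclosed P) :=
  GRing.isSubmodClosed.Build R V (submod_pred h) (submod_pred_closed h).

Section SubmoduleType.
Variables (R : pzRingType) (V : lmodType R) (P : V -> Prop) (h : lclosed P).
Record subm := Subm { subm_val : V; _ : subm_val \in submod_pred h }.
HB.instance Definition _ := [isSub for subm_val].
HB.instance Definition _ := [Choice of subm by <:].
HB.instance Definition _ := [SubChoice_isSubLmodule of subm by <:].

Lemma subm_valP (x : subm) : P (val x).
Proof. by apply/(submod_predP h); apply: valP. Qed.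

(** Vectors outside [P] are sent to 0. *)
Definition tosub (x : V) : subm := insubd (0 : subm) x.
Lemma tosubK x : P x -> val (tosub x) = x.
Proof. by move=> Px; rewrite /tosub insubdK //; apply/submod_predP. Qed.
End SubmoduleType.
Arguments tosub {R V P} h x.

(** * The image of a morphism *)

Section Image.
Variables (K : fieldType) (M N : kmodule K) (f : forall S, M S -> N S).
Hypothesis fh : is_kmor f.

Lemma im_closed (S : comAlgType K) : lclosed (fun y : N S => exists x, f x = y).
Proof.
split; first by exists 0; exact: kmor0 fh _.
  by move=> _ _ [x <-] [y <-]; exists (x + y); exact: (kmorD fh).
by move=> r _ [x <-]; exists (r *: x); exact: (kmorZ fh).
Qed.

Definition imobj (S : comAlgType K) : lmodType S := subm (im_closed S).
(** [kmap g] is known to preserve images only when [g] is an algebra morphism; [tosub] makes the map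
    total. *)
Definition immap (S T : comAlgType K) (g : S -> T) (x : imobj S) : imobj T :=
  tosub (im_closed T) (kmap g (val x)).

Lemma val_immap (S T : comAlgType K) (g : S -> T) : kalg_hom g -> forall x : imobj S,
  val (immap g x) = kmap g (val x).
Proof.
move=> gh x; apply: tosubK; have [y <-] := subm_valP x.
by exists (kmap g y); exact: (kmor_map fh).
Qed.

Definition kim : kmodule K.
Proof.
refine (@KModule K imobj immap _ _ _ _).
- move=> S T g gh x y; apply: val_inj.
  by rewrite raddfD /= !val_immap // raddfD /= kmap_add.
- move=> S T g gh s x; apply: val_inj.
  by rewrite linearZ /= !val_immap // linearZ /= kmap_scale.
- by move=> S x; apply: val_inj; rewrite val_immap ?kmap_id //; exact: kalg_hom_id.
- move=> S T U g g' gh gh' x; apply: val_inj.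
  rewrite val_immap; last exact: kalg_hom_comp.
  by rewrite !val_immap //; exact: kmap_comp.
Defined.

Definition kim_proj (S : comAlgType K) (x : M S) : kim S := tosub (im_closed S) (f x).
Definition kim_inj (S : comAlgType K) (y : kim S) : N S := val (y : imobj S).

Lemma kim_projK (S : comAlgType K) (x : M S) : kim_inj (kim_proj x) = f x.
Proof. by apply: tosubK; exists x. Qed.
Lemma kim_inj_inj (S : comAlgType K) : injective (@kim_inj S).
Proof. exact: val_inj. Qed.
Lemma kim_inj_mor : is_kmor kim_inj.
Proof.
split=> [S x y|S s x|S T g gh x]; [exact: raddfD|exact: linearZ|exact: val_immap].
Qed.
Lemma kim_proj_mor : is_kmor kim_proj.
Proof.
have ih := kim_inj_mor.
split=> [S x y|S s x|S T g gh x]; apply: kim_inj_inj.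
- by rewrite (kmorD ih) !kim_projK (kmorD fh).
- by rewrite (kmorZ ih) !kim_projK (kmorZ fh).
- by rewrite (kmor_map ih) // !kim_projK (kmor_map fh).
Qed.
Lemma kim_proj_surj (S : comAlgType K) (y : kim S) : exists x, kim_proj x = y.
Proof.
have [x e] := subm_valP (y : imobj S); exists x.
by apply: kim_inj_inj; rewrite kim_projK.
Qed.

(** The point [m] stands for the image of [x] under id (x) l, as seen by linear forms on [M]; [l] is
    only K-linear. *)
Definition linear_points (M : kmodule K) := forall (S : comAlgType K) (x : M S) (l : S -> K^o),
  klin l -> exists m : M K^o, forall w : forall U, M U -> kone K U,
    is_kmor w -> w K^o m = l (w S x).

Hypotheses (Nqc : quasi_coherent N) (ML : linear_points M).

Let N0 (n : (N K^o : lmodType K)) := exists x, @f K^o x = n.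

(** By [qc_sep] with N0 = f(M(K)), it is enough that a form [nu] vanishing on [N0] kills f(x). If
    not, some [l] has value 1 at nu(f(x)), and the point [m] given by [ML] has nu(f(m)) = 1. *)
Lemma kim_gen (S : comAlgType K) (y : kim S) :
  exists s : seq (kim K^o * S), y = \sum_(p <- s) p.2 *: ins S p.1.
Proof.
have [x <-] := kim_proj_surj y.
have N0s : subsp N0 by exact: (im_closed K^o).
have [nu nuh nu0|s [sN ys]] := @qc_sep K N Nqc N0 N0s S (f x).
  apply: contrapT => /eqP c0.
  have s0 : subsp (fun x : S => x = 0).
    by split=> // [a b -> ->|k a ->]; rewrite ?addr0 ?scaler0.
  have [l [[lD lZ] _ l1]] := @ex_functional K S _ (nu S (f x)) s0 (elimN eqP c0).
  have [//|m mP] := @ML S x l.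
  have := mP (fun U z => nu U (f z)) (is_kmor_comp fh nuh).
  rewrite l1 nu0; last by exists m.
  by move/eqP; rewrite eq_sym oner_eq0.
exists [seq (tosub (im_closed K^o) p.1 : kim K^o, p.2) | p <- s].
apply: kim_inj_inj; rewrite kim_projK ys big_map (addm_sum (kmorD kim_inj_mor (S:=S))).
apply: eq_big_seq => p /sN Np /=.
by rewrite (kmorZ kim_inj_mor) (kmor_ins kim_inj_mor) /kim_inj tosubK.
Qed.

(** Existence: a projection of N(K) onto f(M(K)) extends [g] to N(K), and the map obtained on N(S)
    is restricted to the image. Uniqueness: [kim_gen]. *)
Lemma kim_qc : quasi_coherent kim.
Proof.
move=> S V g gD gZ.
have N0s : subsp N0 by exact: (im_closed K^o).
have [p [pD pZ pN pid]] := ex_proj N0s.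
pose j (n : N K^o) : kim K^o := tosub (im_closed K^o) (p n).
have jE n : kim_inj (j n) = p n by apply: tosubK; exact: pN.
have [||h [hD hZ hi _]] := Nqc (V := V) (g := fun n => g (j n)).
- move=> x y; rewrite -gD; congr g; apply: kim_inj_inj.
  by rewrite (kmorD kim_inj_mor) !jE pD.
- move=> k x; rewrite -gZ; congr g; apply: kim_inj_inj.
  by rewrite (kmorZ kim_inj_mor) !jE [LHS]pZ.
have gE x : h (kim_inj (ins S x)) = g x.
  rewrite (kmor_ins kim_inj_mor) [LHS]hi; congr g; apply: kim_inj_inj.
  by rewrite jE pid //; exact: (subm_valP (x : imobj K^o)).
exists (fun y => h (kim_inj y)); split=> [x y|s x|//|h' hD' hZ' hi' y].
- by rewrite (kmorD kim_inj_mor) hD.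
- by rewrite (kmorZ kim_inj_mor) hZ.
have [t ->] := kim_gen y.
rewrite (addm_sum (f := h')) // (addm_sum (f := fun y => h (kim_inj y))); last first.
  by move=> a b; rewrite (kmorD kim_inj_mor) hD.
by apply: eq_bigr => q _; rewrite hZ' [h' _]hi' (kmorZ kim_inj_mor) hZ gE.
Qed.

Lemma kim_quotient : qc_quotient kim_proj.
Proof. by split; [exact: kim_proj_mor|exact: kim_proj_surj|exact: kim_qc]. Qed.

Lemma qc_factor : exists (P : kmodule K) (q : forall S, M S -> P S) (phi : forall S, P S -> N S),
  [/\ qc_quotient q, is_kmor phi & forall S x, phi S (q S x) = f x].
Proof.
by exists kim, kim_proj, kim_inj; split; [exact: kim_quotient|exact: kim_inj_mor|exact: kim_projK].
Qed.

End Image.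

(** * Direct sums and tensor modules *)

Section Sum.
Variables (K : fieldType) (N1 N2 : kmodule K).

Definition ksum : kmodule K.
Proof.
refine (@KModule K (fun S => (N1 S * N2 S)%type : lmodType S)
  (fun S T f x => (kmap f x.1, kmap f x.2)) _ _ _ _).
- by move=> S T f fh x y; congr (_, _); exact: kmap_add.
- by move=> S T f fh s x; congr (_, _); exact: kmap_scale.
- by move=> S [x y] /=; rewrite !kmap_id.
- by move=> S T U f g fh gh x; congr (_, _); exact: kmap_comp.
Defined.

Lemma ksum_qc : quasi_coherent N1 -> quasi_coherent N2 -> quasi_coherent ksum.
Proof.
move=> q1 q2 S V g gD gZ.
have [||h1 [h1D h1Z h1i h1u]] := q1 S V (fun n => g (n, 0)).
- by move=> x y; rewrite -gD; congr g; congr (_, _); rewrite addr0.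
- by move=> k x; rewrite -gZ; congr g; congr (_, _); rewrite scaler0.
have [||h2 [h2D h2Z h2i h2u]] := q2 S V (fun n => g (0, n)).
- by move=> x y; rewrite -gD; congr g; congr (_, _); rewrite addr0.
- by move=> k x; rewrite -gZ; congr g; congr (_, _); rewrite scaler0.
exists (fun y : ksum S => h1 y.1 + h2 y.2); split=> [x y|s x|x|h' hD hZ hi y].
- by rewrite h1D h2D addrACA.
- by rewrite h1Z h2Z scalerDr.
- rewrite h1i h2i -gD; case: x => x1 x2; congr g; congr (_, _); [exact: addr0|exact: add0r].
have hD1 : h' (y.1, 0) = h1 y.1.
  apply: (h1u (fun y => h' (y, 0))) => [a b|s a|a].
  - by rewrite -hD; congr h'; congr (_, _); rewrite addr0.
  - by rewrite -hZ; congr h'; congr (_, _); rewrite scaler0.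
  - by rewrite -hi; congr h'; congr (_, _); rewrite [RHS](addm0 (@insD _ _ S)).
have hD2 : h' (0, y.2) = h2 y.2.
  apply: (h2u (fun y => h' (0, y))) => [a b|s a|a].
  - by rewrite -hD; congr h'; congr (_, _); rewrite addr0.
  - by rewrite -hZ; congr h'; congr (_, _); rewrite scaler0.
  - by rewrite -hi; congr h'; congr (_, _); rewrite [RHS](addm0 (@insD _ _ S)).
rewrite -hD1 -hD2 -hD; congr h'; case: (y) => a b.
by congr (_, _); rewrite ?addr0 ?add0r.
Qed.
End Sum.

Section TensorModule.
Variables (K : fieldType) (V : lmodType K).

Definition tmap (S T : comAlgType K) (f : S -> T) : tens V S -> tens V T :=
  tlift (fun v s => pure v (f s)).

Lemma bal_map (S T : comAlgType K) (f : S -> T) : klin f ->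
  balanced (fun (v : V) (s : S) => pure v (f s) : tens V T).
Proof.
move=> [fD fZ]; split=> [v v' s|v s s'|k v s]; first by rewrite pureDl.
  by rewrite fD pureDr.
by rewrite pureZ fZ.
Qed.

Lemma kalg_hom_klin (S T : comAlgType K) (f : S -> T) : kalg_hom f -> klin f.
Proof. by case. Qed.

Lemma tmapD (S T : comAlgType K) (f : S -> T) : klin f -> addm (tmap f).
Proof. by move=> fl; exact: tliftD (bal_map fl). Qed.
Lemma tmap_pure (S T : comAlgType K) (f : S -> T) : klin f ->
  forall v s, tmap f (pure v s) = pure v (f s).
Proof. by move=> fl v s; exact: tlift_pure (bal_map fl) _ _. Qed.

Definition ktens : kmodule K.
Proof.
refine (@KModule K (fun S => tens V S : lmodType S) tmap _ _ _ _).
- by move=> S T f /kalg_hom_klin fh x y; rewrite tmapD.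
- move=> S T f fh s x; have fl := kalg_hom_klin fh.
  apply: (tens_addm_ext (f := fun x => tmap f (s *: x)) (g := fun x => f s *: tmap f x)) x.
  + by move=> x y; rewrite scalerDr tmapD.
  + by move=> x y; rewrite tmapD // scalerDr.
  + move=> v t; rewrite [s *: _]scale_pure !tmap_pure // scale_pure.
    by case: fh => _ ->.
- move=> S x; have il := kalg_hom_klin (@kalg_hom_id K S).
  apply: (tens_addm_ext (f := tmap _) (g := id)) x => // [|v t]; first exact: tmapD.
  by rewrite tmap_pure.
- move=> S T U f g fh gh x; have fl := kalg_hom_klin fh; have gl := kalg_hom_klin gh.
  have cl := kalg_hom_klin (kalg_hom_comp fh gh).
  apply: (tens_addm_ext (f := tmap _) (g := fun x => tmap g (tmap f x))) x => [|a b|v t].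
  + exact: tmapD.
  + by rewrite !tmapD.
  + by rewrite !tmap_pure.
Defined.

Lemma ktens_ins (S : comAlgType K) (v : V) (k : K) :
  ins S (pure v (k : K^o) : ktens K^o) = pure v k%:A :> ktens S.
Proof. by rewrite [LHS]tmap_pure //; apply/kalg_hom_klin/kstr_hom. Qed.

Lemma ktens_qc : quasi_coherent ktens.
Proof.
move=> S W g gD gZ.
(* The K-points of [ktens] are V (x) K and not V, so [v] enters as v (x) 1. *)
pose B (v : V) (s : S) : W := s *: g (pure v 1).
have bB : balanced B.
  split=> [v v' s|v s s'|k v s]; first by rewrite /B pureDl gD scalerDr.
    by rewrite /B scalerDl.
  rewrite /B (_ : pure (k *: v) 1 = k *: (pure v 1 : ktens K^o)).
    by rewrite gZ scalerA /kstr -scalerAr mulr1.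
  by rewrite pureZ [RHS]scale_pure.
exists (tlift B); split=> [x y|s x|x|h' hD hZ hi y].
- by rewrite tliftD.
- apply: (tens_addm_ext (f := fun x => tlift B (s *: x)) (g := fun x => s *: tlift B x)) x.
  + by move=> x y; rewrite scalerDr tliftD.
  + by move=> x y; rewrite tliftD // scalerDr.
  + by move=> v t; rewrite scale_pure !tlift_pure // /B scalerA.
- apply: (tens_addm_ext (f := fun x => tlift B (ins S (x : ktens K^o))) (g := g)) x => [a b|//|v k].
    by rewrite [ins S _]insD tliftD.
  rewrite ktens_ins tlift_pure // /B -[_ *: _]/(kstr S k *: _) -gZ; congr g.
  by rewrite [LHS]scale_pure mulr1.
- apply: (tens_addm_ext (f := h') (g := tlift B)) y => // [|v s]; first exact: tliftD.
  have := hi (pure v 1); rewrite -[kmap _ _]/(ins S _) ktens_ins scale1r => e.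
  by rewrite tlift_pure // /B -e -hZ [s *: _]scale_pure mulr1.
Qed.
End TensorModule.

(** * Square-zero extensions and duals of quasi-coherent modules *)

Section SquareZero.
Variables (K : fieldType) (A : comAlgType K) (V : lmodType A).

(* [sqz] is [A (+) eps V] with [eps^2 = 0]. *)
Definition sqz : Type := (A * V)%type.
HB.instance Definition _ := GRing.Zmodule.on sqz.

Definition sqz_mul (x y : sqz) : sqz := (x.1 * y.1, x.1 *: y.2 + y.1 *: x.2).

Lemma sqz_mulA : associative sqz_mul.
Proof.
move=> x y z; congr (_, _); rewrite /= ?mulrA //.
by rewrite !scalerDr !scalerA addrA (mulrC z.1) (mulrC z.1).
Qed.
Lemma sqz_mulC : commutative sqz_mul.
Proof. by move=> x y; congr (_, _); rewrite /= 1?mulrC // addrC. Qed.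
Lemma sqz_mul1 : left_id ((1, 0) : sqz) sqz_mul.
Proof. by case=> a v; congr (_, _); rewrite /= ?mul1r // scale1r scaler0 addr0. Qed.
Lemma sqz_mulDl : left_distributive sqz_mul +%R.
Proof.
move=> x y z; congr (_, _); rewrite /= ?mulrDl //.
by rewrite scalerDl scalerDr addrACA.
Qed.
Lemma sqz_one_neq0 : ((1, 0) : sqz) != 0.
Proof. by apply/eqP => -[] /eqP; rewrite oner_eq0. Qed.
HB.instance Definition _ := GRing.Zmodule_isComNzRing.Build sqz
  sqz_mulA sqz_mulC sqz_mul1 sqz_mulDl sqz_one_neq0.

(** [V] is a module over [A] only, so K acts on it through the image of [k] in [A]. *)
Definition sqz_scale (k : K) (x : sqz) : sqz := (k *: x.1, k%:A *: x.2).
Lemma sqz_scaleA a b x : sqz_scale a (sqz_scale b x) = sqz_scale (a * b) x.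
Proof. by congr (_, _); rewrite /= scalerA // -scalerAl mul1r scalerA. Qed.
Lemma sqz_scale1 : left_id 1 sqz_scale.
Proof. by case=> a v; congr (_, _); rewrite /= !scale1r. Qed.
Lemma sqz_scaleDr : right_distributive sqz_scale +%R.
Proof. by move=> k x y; congr (_, _); rewrite /= scalerDr. Qed.
Lemma sqz_scaleDl x : {morph sqz_scale^~ x : a b / a + b}.
Proof. by move=> a b; congr (_, _); rewrite /= ?scalerDl. Qed.
HB.instance Definition _ := GRing.Zmodule_isLmodule.Build K sqz
  sqz_scaleA sqz_scale1 sqz_scaleDr sqz_scaleDl.

Lemma sqz_scaleAl (k : K) (x y : sqz) : k *: (x * y) = (k *: x) * y.
Proof.
congr (_, _); rewrite /= ?scalerAl // scalerDr !scalerA -scalerAl mul1r.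
by rewrite -!scalerAl !mul1r -scalerAr mulr1.
Qed.
HB.instance Definition _ := GRing.Lmodule_isLalgebra.Build K sqz sqz_scaleAl.
HB.instance Definition _ := GRing.Lalgebra_isComAlgebra.Build K sqz.

Lemma sqzM (x y : sqz) : x * y = (x.1 * y.1, x.1 *: y.2 + y.1 *: x.2). Proof. by []. Qed.

Definition sqz_in (a : A) : sqz := (a, 0).
Definition sqz_eps (v : V) : sqz := (0, v).

Lemma sqz_in_hom : kalg_hom sqz_in.
Proof.
split=> [x y|x y|//|k x]; congr (_, _).
- by rewrite addr0.
- by rewrite !scaler0 addr0.
- by rewrite scaler0.
Qed.

Lemma sqz_eps_klin : (addm sqz_eps) /\ forall (k : K) v, sqz_eps (k%:A *: v) = k *: sqz_eps v.
Proof.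
by split=> [x y|k v]; congr (_, _); rewrite /= ?addr0 ?scaler0.
Qed.
End SquareZero.
Arguments sqz {K} A V.
Arguments sqz_in {K A} V a.
Arguments sqz_eps {K A V} v.

Section SquareZeroMap.
Variables (K : fieldType) (A B : comAlgType K) (V : lmodType A) (W : lmodType B).
Variables (f : A -> B) (g : V -> W).
Hypotheses (fh : kalg_hom f) (gD : addm g) (gZ : forall a v, g (a *: v) = f a *: g v).

Definition sqz_map (x : sqz A V) : sqz B W := (f x.1, g x.2).

Lemma sqz_map_hom : kalg_hom sqz_map.
Proof.
have [fD fM f1 fZ] := fh.
split=> [x y|x y||k x]; congr (_, _) => /=.
- by rewrite fD.
- by rewrite gD.
- by rewrite fM.
- by rewrite gD !gZ.
- by rewrite f1.
- exact: addm0.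
- by rewrite fZ.
- by rewrite gZ fZ f1.
Qed.
End SquareZeroMap.

(** * Elements of M^*(T) *)

Section Duals.
Variables (K : fieldType).

Lemma dual_eltZ (M : kmodule K) (T : comAlgType K) (t : T) (w : dual_raw M T) :
  dual_elt w -> dual_elt (dual_scale t w).
Proof.
move=> h U tau tauh; have [D Z m] := h U tau tauh.
split=> [x y|u x|U' g tau' gh e x]; rewrite /dual_scale.
- by rewrite D mulrDr.
- by rewrite Z mulrCA.
- by rewrite (m _ _ _ gh e) -e; case: gh => _ ->.
Qed.

Lemma dual_elt_map (M : kmodule K) (T T' : comAlgType K) (g : T -> T') (w : dual_raw M T) :
  kalg_hom g -> dual_elt w -> dual_elt (dual_map g w).
Proof.
move=> gh h U tau tauh; have [D Z m] := h U _ (kalg_hom_comp gh tauh).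
split=> [x y|u x|U' g' tau' gh' e x]; rewrite /dual_map ?D ?Z //.
by apply: m => // t; rewrite e.
Qed.

Lemma dual_elt_pull (M N : kmodule K) (q : forall S, M S -> N S) (T : comAlgType K)
    (v : dual_raw N T) : is_kmor q -> dual_elt v ->
  dual_elt (fun U tau x => v U tau (q U x)).
Proof.
move=> qh h U tau tauh; have [D Z m] := h U tau tauh.
split=> [x y|u x|U' g tau' gh e x]; first by rewrite (kmorD qh) D.
  by rewrite (kmorZ qh) Z.
by rewrite (kmor_map qh) // (m _ _ _ gh e).
Qed.

(** The base change to [T] of an element of M^*(K); it ignores [tau]. *)
Lemma dual_form (M : kmodule K) (nu : forall S, M S -> kone K S) (T : comAlgType K) :
  is_kmor nu -> dual_elt (fun U (tau : T -> U) x => nu U x : U).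
Proof.
move=> nuh U tau tauh; split=> [x y|u x|U' g tau' gh e x].
- exact: (kmorD nuh).
- exact: (kmorZ nuh).
- exact: (kmor_map nuh).
Qed.

Section QCDual.
Variables (N : kmodule K) (Nqc : quasi_coherent N).

(** An element of N^*(T) is built from its K-linear restriction N(K) -> T. *)
Lemma qc_dual (T : comAlgType K) (phi : N K^o -> T) : addm phi ->
  (forall (k : K) n, phi ((k : K^o) *: n) = k *: phi n) ->
  exists w : dual_raw N T, dual_elt w /\
    forall (U : comAlgType K) (tau : T -> U), kalg_hom tau ->
    forall n, w U tau (ins U n) = tau (phi n).
Proof.
move=> pD pZ.
(* [dual_raw] is indexed by all functions [tau]; those that are not algebra morphisms get the zero
   map. *)
have H (U : comAlgType K) (tau : T -> U) : exists h : N U -> U, kalg_hom tau ->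
    [/\ addm h, forall (u : U) x, h (u *: x) = u * h x &
      forall n, h (ins U n) = tau (phi n)].
  have [tauh|nt] := lem (kalg_hom tau); last by exists (fun _ => 0) => /nt.
  have [tD tM t1 tZ] := tauh.
  have [||h [hD hZ hi _]] := Nqc (V := U^o : lmodType U) (g := fun n => tau (phi n)).
  - by move=> x y; rewrite pD tD.
  - by move=> k x; rewrite pZ tZ /kstr [RHS]mulr_algl.
  - by exists h.
pose w (U : comAlgType K) (tau : T -> U) := sval (cid (H U tau)).
have wP (U : comAlgType K) (tau : T -> U) : kalg_hom tau ->
    [/\ addm (w U tau), forall (u : U) x, w U tau (u *: x) = u * w U tau x &
      forall n, w U tau (ins U n) = tau (phi n)] by exact: svalP (cid (H U tau)).
clearbody w.
exists w; split=> [U tau tauh|U tau tauh n]; last by have [_ _ h] := wP U tau tauh; exact: h.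
have [D Z i] := wP U tau tauh; split=> // U' h tau' hh e.
have tauh' : kalg_hom tau'.
  by rewrite (_ : tau' = fun t => h (tau t)); [exact: kalg_hom_comp|apply: funext].
have [D' Z' i'] := wP U' tau' tauh'; have [hD hM _ _] := hh.
apply: (qc_ext Nqc) => [x y|x y|s n].
- by rewrite kmap_add // D'.
- by rewrite D hD.
- by rewrite kmap_scale // Z' Z hM ins_map // i' i e.
Qed.

Lemma qc_dual_ext (T : comAlgType K) (w w' : dual_raw N T) : dual_elt w -> dual_elt w' ->
  (forall (U : comAlgType K) (tau : T -> U), kalg_hom tau ->
    forall n, w U tau (ins U n) = w' U tau (ins U n)) ->
  dual_eq w w'.
Proof.
move=> h h' e U tau tauh; have [D Z m] := h U tau tauh; have [D' Z' m'] := h' U tau tauh.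
by apply: (qc_ext Nqc) => // s n; rewrite Z Z' e.
Qed.

(* The value of [Psi] on the universal form [N -> S (+) eps N(S)] lies over the
   element of [N(S)] representing [Psi]: any form [w] with values in [T] is, up to
   multiplication by [eps], the image of the universal one under an algebra
   morphism [S (+) eps N(S) -> T (+) eps T]. *)
Lemma qc_reflexive (S : comAlgType K) (Psi : bidual_raw N S) : bidual_elt Psi ->
  exists y : N S, bidual_eq (bidual_ev y) Psi.
Proof.
move=> PsiE.
have [epsD epsZ] := @sqz_eps_klin K S (N S).
have [||w0 [w0h w0E]] := @qc_dual (sqz S (N S)) (fun n => sqz_eps (ins S n)).
- by move=> x y; rewrite insD epsD.
- by move=> k x; rewrite insZ epsZ.
pose iota := sqz_in (A := S) (N S).
have iotah : kalg_hom iota by exact: sqz_in_hom.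
exists (Psi _ iota w0).2 => T sg sgh w wh; rewrite /bidual_ev.
have [wD wZ wm] := wh T _ (@kalg_hom_id K T).
pose phi (n : N S) : T^o := w T (fun t => t) (kmap sg n).
pose g := sqz_map (V := N S) (W := T^o) sg phi.
have gh : kalg_hom g.
  apply: sqz_map_hom => // [x y|a v]; first by rewrite /phi kmap_add // wD.
  by rewrite /phi kmap_scale // wZ.
pose j := sqz_in (A := T) T^o.
have jh : kalg_hom j by exact: sqz_in_hom.
have jsh := kalg_hom_comp sgh jh.
(* Both forms send n to eps w(n), the left one because [g] is [phi] on the eps part. *)
have e : dual_eq (dual_map g w0) (dual_scale (sqz_eps (1 : T^o)) (dual_map j w)).
  apply: qc_dual_ext => [||U tau tauh n].
  - exact: dual_elt_map.
  - exact/dual_eltZ/dual_elt_map.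
  rewrite /dual_map /dual_scale w0E; last exact: kalg_hom_comp.
  have -> : w U (fun t => tau (j t)) (ins U n) = tau (j (w T (fun t => t) (ins T n))).
    have tjh := kalg_hom_comp jh tauh.
    by rewrite -(ins_map tjh); apply: wm.
  have [_ tM _ _] := tauh; rewrite -tM; congr tau.
  rewrite sqzM; congr (_, _) => /=.
    by rewrite mul0r; case: sgh => sD _ _ _; exact: addm0.
  by rewrite scale0r add0r /phi ins_map //; exact: esym (mulr1 _).
(* Naturality of [Psi] along [g] and along [j] computes its value on the two equal forms; the eps
   parts are w(y) and Psi(w). *)
have [_ _ _ /(_ _ g (fun s => j (sg s)) gh)] := PsiE _ iota iotah.
move=> /(_ _ w0 w0h) Eg.
have [_ _ _ /(_ _ j (fun s => j (sg s)) jh)] := PsiE _ sg sgh.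
move=> /(_ (fun=> erefl) w wh) Ej.
have [Peq _ PZ _] := PsiE _ _ jsh.
have := Peq _ _ (dual_elt_map gh w0h) (dual_eltZ _ (dual_elt_map jh wh)) e.
rewrite PZ ?Ej; last exact: dual_elt_map.
rewrite Eg.
  move/(congr1 snd) => /= E; rewrite -[LHS]/(phi _) E scale0r add0r; exact: mulr1.
move=> s; congr (_, _); rewrite /phi.
rewrite (addm0 (kmap_add sgh)); exact: (addm0 wD).
Qed.

End QCDual.
End Duals.

(** * Dual elements as morphisms to tensor modules *)

Section DualTensor.
Variable K : fieldType.

Lemma talg_hom (A B C : comAlgType K) (f : A -> C) (g : B -> C) (F : talg A B -> C) :
  kalg_hom f -> kalg_hom g -> addm F -> (forall a b, F (tpure a b) = f a * g b) -> kalg_hom F.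
Proof.
move=> [fD fM f1 fZ] [gD gM g1 gZ] FD FE; split=> // [x y||k x].
- apply: (talg_ext (f := fun x => F (x * y)) (g := fun x => F x * F y)) x => [a b|a b|a b].
  + by rewrite mulrDl FD.
  + by rewrite FD mulrDl.
  apply: (talg_ext (f := fun y => F (_ * y)) (g := fun y => _ * F y)) y => [c d|c d|c d].
  + by rewrite mulrDr FD.
  + by rewrite FD mulrDr.
  by rewrite tpureM !FE fM gM mulrACA.
- by rewrite -tpure1 FE f1 g1 mulr1.
- apply: (talg_ext (f := fun x => F (k *: x)) (g := fun x => k *: F x)) x => [a b|a b|a b].
  + by rewrite scalerDr FD.
  + by rewrite FD scalerDr.
  by rewrite tpureZl !FE fZ scalerAl.
Qed.

(** [talg A B] and [ktens A B] at [B] share their carrier; this converts scalars of the module into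
    products of the algebra. *)
Lemma talg_scaleE (A B : comAlgType K) (b : B) (x : talg A B) :
  tpure 1 b * x = b *: (x : ktens A B).
Proof.
apply: (talg_ext (f := fun x => tpure 1 b * x) (g := fun x : ktens A B => b *: x)) x
    => [x y|x y|a c].
- by rewrite mulrDr.
- by rewrite scalerDr.
- by rewrite tpureM mul1r [RHS]scale_pure.
Qed.

Lemma tmap_hom (A B C : comAlgType K) (f : B -> C) : kalg_hom f ->
  kalg_hom (@tmap K A B C f : talg A B -> talg A C).
Proof.
move=> fh; have fl := kalg_hom_klin fh.
apply: (talg_hom (tpure_inl A C) (kalg_hom_comp fh (tpure_inr A C))) => [|a b].
  exact: tmapD.
by rewrite [LHS]tmap_pure // tpureM mulr1 mul1r.
Qed.

Definition contract (T U : comAlgType K) (tau : T -> U) : talg T U -> U :=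
  tlift (fun t u => tau t * u).

Lemma bal_contract (T U : comAlgType K) (tau : T -> U) : kalg_hom tau ->
  balanced (fun (t : T) (u : U) => tau t * u).
Proof.
move=> [tD _ _ tZ]; split=> [t t' u|t u u'|k t u].
- by rewrite tD mulrDl.
- by rewrite mulrDr.
- by rewrite tZ -scalerAl scalerAr.
Qed.

Lemma contract_pure (T U : comAlgType K) (tau : T -> U) : kalg_hom tau ->
  forall t u, contract tau (tpure t u) = tau t * u.
Proof. by move=> th t u; exact: tlift_pure (bal_contract th) _ _. Qed.

Lemma contractD (T U : comAlgType K) (tau : T -> U) : kalg_hom tau -> addm (contract tau).
Proof. by move=> th; exact: tliftD (bal_contract th). Qed.

Lemma contract_hom (T U : comAlgType K) (tau : T -> U) : kalg_hom tau -> kalg_hom (contract tau).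
Proof.
move=> th; apply: (talg_hom th (@kalg_hom_id K U)); first exact: contractD.
exact: contract_pure.
Qed.

Lemma contractZ (T U : comAlgType K) (tau : T -> U) : kalg_hom tau ->
  forall u (x : ktens T U), contract tau (u *: x) = u * contract tau x.
Proof.
move=> th u x; rewrite -talg_scaleE; case: (contract_hom th) => _ -> _ _.
by rewrite contract_pure //; case: (th) => _ _ -> _; rewrite mul1r.
Qed.

Variable M : kmodule K.

(** [w] accepts only points over T-algebras, so [x] is first carried from [U] to T (x) U. *)
Definition dtens (T : comAlgType K) (w : dual_raw M T) (U : comAlgType K) (x : M U) : ktens T U :=
  w (talg T U) (fun t => tpure t 1) (kmap (tpure 1) x).

Lemma dtens_mor (T : comAlgType K) (w : dual_raw M T) : dual_elt w -> is_kmor (dtens w).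
Proof.
move=> wh; split=> [U x y|U u x|U U' f fh x].
- have [D _ _] := wh _ _ (tpure_inl T U).
  by rewrite /dtens kmap_add ?D //; exact: tpure_inr.
- have [_ Z _] := wh _ _ (tpure_inl T U).
  by rewrite /dtens kmap_scale ?Z; [exact: talg_scaleE|exact: tpure_inr].
have [_ _ m] := wh _ _ (tpure_inl T U).
rewrite /dtens -[RHS](m (talg T U') (tmap f) (fun t => tpure t 1) (tmap_hom T fh)) => [|t].
  rewrite -kmap_comp; [|exact: fh|exact: tpure_inr].
  rewrite -kmap_comp; [|exact: tpure_inr|exact: tmap_hom].
  rewrite (_ : (fun u => tmap f (tpure 1 u)) = fun u => tpure 1 (f u)) //.
  by apply: funext => u; rewrite [LHS]tmap_pure //; exact: kalg_hom_klin.
rewrite [LHS]tmap_pure; last exact: kalg_hom_klin.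
by case: fh => _ _ ->.
Qed.

(** [contract tau] is a morphism of T-algebras and a retraction of U -> T (x) U, so naturality of
    [w] along it gives back w(x). *)
Lemma dtensK (T : comAlgType K) (w : dual_raw M T) : dual_elt w ->
  forall (U : comAlgType K) (tau : T -> U), kalg_hom tau ->
  forall x, contract tau (dtens w x) = w U tau x.
Proof.
move=> wh U tau th x; have [_ _ m] := wh _ _ (tpure_inl T U).
rewrite /dtens -[LHS](m U (contract tau) tau (contract_hom th)) => [|t].
  rewrite -kmap_comp; [|exact: tpure_inr|exact: contract_hom].
  rewrite (_ : (fun s => _) = id) ?kmap_id //; apply: funext => u.
  by rewrite contract_pure //; case: th => _ _ -> _; rewrite mul1r.
by rewrite contract_pure // mulr1.
Qed.

End DualTensor.

(** * Limits of quasi-coherent modules *)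

Section LimitLinearPoints.
Variables (K : fieldType) (M : kmodule K).
Hypothesis Mlim : qlim_iso M.

(** The images of [x] under the maps id (x) l on the quotients form a compatible family, hence a
    point of M(T). *)
Lemma lim_basechange (S T : comAlgType K) (l : S -> T) (x : M S) : klin l ->
  exists y : M T, forall (N : kmodule K) (q : forall S', M S' -> N S'), qc_quotient q ->
    forall b : N S -> N T, addm b -> (forall s n, b (s *: ins S n) = l s *: ins T n) ->
    q T y = b (q S x).
Proof.
move=> ll.
(* A family in [qlim_raw] has a value at every [N]; where [N] is not quasi-coherent it is taken to
   be 0. *)
have H (N : kmodule K) : exists b : N S -> N T, quasi_coherent N ->
    addm b /\ forall s n, b (s *: ins S n) = l s *: ins T n.
  have [Nqc|nN] := lem (quasi_coherent N); last by exists (fun=> 0) => /nN.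
  by have [b bP] := qc_basechange Nqc ll; exists b.
pose b (N : kmodule K) := sval (cid (H N)).
have bP (N : kmodule K) : quasi_coherent N ->
    addm (b N) /\ forall s n, b N (s *: ins S n) = l s *: ins T n by exact: svalP (cid (H N)).
clearbody b.
have [_ /(_ (fun N q => b N (q S x)))[|y yP]] := Mlim T.
  move=> N N' q q' f [_ _ Nqc] [_ _ Nqc'] fh fq.
  have [bD bE] := bP _ Nqc; have [bD' bE'] := bP _ Nqc'.
  rewrite -fq; apply: (qc_ext Nqc (f := fun z => f T (b N z)) (g := fun z => b N' (f S z)))
    => [u v|u v|s n].
  - by rewrite bD (kmorD fh).
  - by rewrite (kmorD fh) bD'.
  - by rewrite bE !(kmorZ fh) !(kmor_ins fh) bE'.
exists y => N q qq b' bD' bE'; rewrite yP //; have [_ _ Nqc] := qq.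
have [bD bE] := bP _ Nqc.
by apply: (qc_ext Nqc) => // s n; rewrite bE bE'.
Qed.

(* Both [x] and its image [m] under [l] are recovered, up to multiplication by
   [eps], from the image [x'] of [x] under [s |-> eps s : S -> K (+) eps S], and by
   algebra morphisms only. *)
Lemma lim_linear_points : linear_points M.
Proof.
move=> S x l [lD lZ].
pose S' : lmodType K^o := S.
pose A := sqz (K^o : comAlgType K) S'.
pose e : S -> A := fun s => sqz_eps (s : S').
have el : klin e.
  by have [D Z] := @sqz_eps_klin K K^o S'; split=> // k s; rewrite -Z /= [k%:A]mulr1.
have ll : klin l by [].
have [x' x'P] := lim_basechange x el.
have [m mP] := lim_basechange x ll.
exists m => w wh.
(* [i] and [r] are algebra morphisms although [l] is not multiplicative, since products of eps parts
   vanish. *)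
pose i := sqz_map (A := K^o) (V := S') (W := S^o) (@kstr K S) (id : S -> S^o).
have ih : kalg_hom i.
  apply: sqz_map_hom; [exact: kstr_hom|by []|move=> a v].
  exact: esym (mulr_algl (a : K) (v : S)).
pose r := sqz_map (A := K^o) (B := K^o) (V := S') (W := (K^o)^o) id (l : S -> K^o).
have rh : kalg_hom r by apply: sqz_map_hom => //; exact: kalg_hom_id.
pose iS := sqz_in (A := S) S^o; have iSh : kalg_hom iS by exact: sqz_in_hom.
pose iK := sqz_in (A := K^o) (K^o)^o; have iKh : kalg_hom iK by exact: sqz_in_hom.
have Ei : kmap i x' = sqz_eps (1 : S^o) *: kmap iS x.
  have [inj _] := Mlim (sqz S S^o); apply: inj => N q qq.
  have [qh _ Nqc] := qq.
  have [b [bD bE]] := qc_basechange Nqc el.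
  rewrite (kmor_map qh) // (kmorZ qh) (kmor_map qh) // (x'P _ _ qq _ bD bE).
  apply: (qc_ext Nqc (f := fun z => kmap i (b z)) (g := fun z => _ *: kmap iS z)) => [u v|u v|s n].
  - by rewrite bD kmap_add.
  - by rewrite kmap_add // scalerDr.
  rewrite bE !kmap_scale // !ins_map // scalerA; congr (_ *: _).
  rewrite sqzM; congr (_, _); rewrite /= ?mul0r ?(addm0 (kalg_hom_klin (@kstr_hom K S)).1) //.
  by rewrite scale0r add0r; exact: esym (mulr1 _).
have Er : kmap r x' = sqz_eps (1 : (K^o)^o) *: kmap iK m.
  have [inj _] := Mlim (sqz K^o (K^o)^o); apply: inj => N q qq.
  have [qh _ Nqc] := qq.
  have [b [bD bE]] := qc_basechange Nqc el.
  have [c [cD cE]] := qc_basechange Nqc ll.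
  rewrite (kmor_map qh) // (kmorZ qh) (kmor_map qh) // (x'P _ _ qq _ bD bE) (mP _ _ qq _ cD cE).
  apply: (qc_ext Nqc (f := fun z => kmap r (b z)) (g := fun z => _ *: kmap iK (c z)))
    => [u v|u v|s n].
  - by rewrite bD kmap_add.
  - by rewrite cD kmap_add // scalerDr.
  rewrite bE cE !kmap_scale // !ins_map // scalerA; congr (_ *: _).
  rewrite sqzM; congr (_, _); rewrite /= ?mul0r //.
  by rewrite scale0r add0r; exact: esym (mulr1 _).
(* Comparing eps parts, naturality along [i] identifies the eps part of w(x') with w(x), and
   naturality along [r] identifies its image under [l] with w(m). *)
have := kmor_map wh ih x'; rewrite Ei (kmorZ wh) (kmor_map wh) //.
move/(congr1 snd) => /= Ewi.
have := kmor_map wh rh x'; rewrite Er (kmorZ wh) (kmor_map wh) //.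
move/(congr1 snd) => /= Ewr.
have h1 : w S x = (w _ x' : A).2.
  by rewrite -[RHS]Ewi scale0r add0r; exact: esym (mulr1 _).
rewrite h1 -[RHS]Ewr scale0r add0r; exact: esym (mulr1 _).
Qed.

End LimitLinearPoints.

(** * A limit of quasi-coherent quotients is reflexive *)

Section LimitReflexive.
Variables (K : fieldType) (M : kmodule K).

(** [Phi] induces an element of N^**(S) for each quotient, represented by a point of N(S) by
    [qc_reflexive]. These points are compatible and define [m]; it represents [Phi] because every
    [w] factors through a quotient. *)
Lemma lim_reflexive : qlim_iso M -> kreflexive M.
Proof.
move=> Mlim S; have ML := lim_linear_points Mlim; split=> [m m' mm'|Phi PhiE].
  have [inj _] := Mlim S; apply: inj => N q [qh _ Nqc].
  apply: (qc_sep0 Nqc) => nu nuh.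
  have := mm' S _ (@kalg_hom_id K S) _ (dual_form (T := S) (is_kmor_comp qh nuh)).
  by rewrite /bidual_ev !kmap_id.
have PhiP (N : kmodule K) (q : forall S', M S' -> N S') : is_kmor q ->
    bidual_elt (fun T sg (v : dual_raw N T) => Phi T sg (fun U tau x => v U tau (q U x))).
  move=> qh T sg sgh; have [Peq PD PZ Pm] := PhiE T sg sgh.
  split=> [v v' vh vh' e|v v' vh vh'|t v vh|T' g sg' gh e v vh].
  - by apply: Peq; [exact: dual_elt_pull|exact: dual_elt_pull|move=> U tau th x; exact: e].
  - by rewrite -PD //; exact: dual_elt_pull.
  - by rewrite -PZ //; exact: dual_elt_pull.
  - by rewrite -(Pm _ _ _ gh e); last exact: dual_elt_pull.
(* The value is 0 at pairs that are not quasi-coherent quotients. *)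
have H (N : kmodule K) (q : forall S', M S' -> N S') : exists y : N S, qc_quotient q ->
    bidual_eq (bidual_ev y)
      (fun T sg (v : dual_raw N T) => Phi T sg (fun U tau x => v U tau (q U x))).
  have [[qh _ Nqc]|nq] := lem (qc_quotient q); last by exists 0 => /nq.
  by have [y yP] := qc_reflexive Nqc (PhiP N q qh); exists y.
pose y N q := sval (cid (H N q)).
have yP (N : kmodule K) (q : forall S', M S' -> N S') : qc_quotient q ->
    bidual_eq (bidual_ev (y N q))
      (fun T sg (v : dual_raw N T) => Phi T sg (fun U tau x => v U tau (q U x))).
  exact: svalP (cid (H N q)).
clearbody y.
have idh := @kalg_hom_id K S.
have [_ /(_ y)[|m mP]] := Mlim S.
  move=> N N' q q' f qq qq' fh fq; have [qh _ Nqc] := qq; have [qh' _ Nqc'] := qq'.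
  apply: (qc_sep0 Nqc') => nu nuh.
  have := yP _ _ qq S _ idh _ (dual_form (T := S) (is_kmor_comp fh nuh)).
  have := yP _ _ qq' S _ idh _ (dual_form (T := S) nuh).
  rewrite /bidual_ev !kmap_id => -> ->.
  have [Peq _ _ _] := PhiE S _ idh; apply: Peq.
  - exact: (dual_elt_pull qh (dual_form (T := S) (is_kmor_comp fh nuh))).
  - exact: (dual_elt_pull qh' (dual_form (T := S) nuh)).
  - by move=> U tau _ z; rewrite fq.
exists m => T sg sgh w wh.
have [P [q [phi [qq phih phiE]]]] := qc_factor (dtens_mor wh) (@ktens_qc K T) ML.
have [qh _ Pqc] := qq.
(* [dtens w] factors as [phi] after [q]; contracting [phi] gives a form on [P] whose pullback along
   [q] is [w]. *)
pose v : dual_raw P T := fun U tau n => contract tau (phi U n).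
have vE (U : comAlgType K) (tau : T -> U) : kalg_hom tau -> forall x, v U tau (q U x) = w U tau x.
  by move=> th x; rewrite /v phiE dtensK.
have vh : dual_elt v.
  move=> U tau th; split=> [a b|u a|U' h tau' hh e a].
  - by rewrite /v (kmorD phih) contractD.
  - by rewrite /v (kmorZ phih) contractZ.
  have [_ qs _] := qq; have [b <-] := qs U a.
  have th' : kalg_hom tau'.
    by rewrite (_ : tau' = fun t => h (tau t)); [exact: kalg_hom_comp|apply: funext].
  rewrite -(kmor_map qh) // !vE //; have [_ _ wm] := wh U tau th; exact: wm.
have [Peq _ _ _] := PhiE T sg sgh.
rewrite -(Peq _ _ (dual_elt_pull qh vh) wh); last by move=> U tau th x; exact: vE.
by rewrite -[RHS](yP _ _ qq T sg sgh v vh) /bidual_ev -mP // -(kmor_map qh) // vE.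
Qed.

End LimitReflexive.

Section DualTensorMaps.
Variables (K : fieldType) (T T' : comAlgType K).

(** Scaling a dual element by [t] composes its [dtens] with this morphism. *)
Lemma dtens_scale_mor (t : T) : is_kmor (M := ktens T) (N := ktens T)
  (fun U (x : ktens T U) => (tpure t 1 : talg T U) * (x : talg T U)).
Proof.
split=> [S x y|S s x|S S' f fh x]; first exact: (mulrDr (tpure t 1 : talg T S)).
  by rewrite -!talg_scaleE mulrCA.
have [_ fM f1 _] := fh.
have [_ tM _ _] := tmap_hom T fh.
rewrite [RHS](tM (tpure t 1) x) [tmap f (tpure t 1)]tmap_pure ?f1 //.
exact: kalg_hom_klin.
Qed.

Variables (g : T -> T') (gh : kalg_hom g).

Definition tgmap (U : comAlgType K) : talg T U -> talg T' U :=
  tlift (fun t u => pure (g t) u).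

Lemma bal_gmap (U : comAlgType K) : balanced (fun (t : T) (u : U) => tpure (g t) u).
Proof.
have [gD _ _ gZ] := gh; split=> [t t' u|t u u'|k t u].
- by rewrite gD tpureDl.
- by rewrite tpureDr.
- by rewrite gZ -tpureZl tpureZr.
Qed.

Lemma tgmapD (U : comAlgType K) : addm (@tgmap U).
Proof. exact: tliftD (bal_gmap U). Qed.
Lemma tgmap_pure (U : comAlgType K) t u : @tgmap U (tpure t u) = tpure (g t) u.
Proof. exact: tlift_pure (bal_gmap U) _ _. Qed.

Lemma tgmap_hom (U : comAlgType K) : kalg_hom (@tgmap U).
Proof.
apply: (talg_hom (kalg_hom_comp gh (tpure_inl T' U)) (tpure_inr T' U)); first exact: tgmapD.
by move=> t u; rewrite tgmap_pure tpureM mulr1 mul1r.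
Qed.

Lemma tgmap_mor : is_kmor (M := ktens T) (N := ktens T') tgmap.
Proof.
split=> [U|U u x|U U' f fh x]; first exact: tgmapD.
  rewrite -!talg_scaleE; case: (tgmap_hom U) => _ -> _ _.
  by rewrite tgmap_pure; case: gh => _ _ ->.
have fl := kalg_hom_klin fh.
apply: (talg_ext (f := fun x => tgmap (tmap f x)) (g := fun x => tmap f (tgmap x))) x
    => [x y|x y|a b].
- by rewrite [tmap _ _]tmapD // tgmapD.
- by rewrite tgmapD [LHS]tmapD.
- by rewrite tgmap_pure [tmap f _]tmap_pure // tgmap_pure [RHS]tmap_pure.
Qed.

Lemma dtens_map (M : kmodule K) (w : dual_raw M T) : dual_elt w ->
  forall (U : comAlgType K) (x : M U), dtens (dual_map g w) x = tgmap (dtens w x).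
Proof.
move=> wh U x; have [_ _ m] := wh _ _ (tpure_inl T U).
rewrite /dtens -[RHS](m (talg T' U) (@tgmap U) (fun t => tpure (g t) 1) (tgmap_hom U)).
  rewrite -kmap_comp; [|exact: tpure_inr|exact: tgmap_hom].
  rewrite (_ : (fun u => tgmap (tpure 1 u)) = tpure 1) //.
  by apply: funext => u; rewrite tgmap_pure; case: gh => _ _ ->.
by move=> t; rewrite tgmap_pure.
Qed.

End DualTensorMaps.

(** * Reflexive modules *)

Section Reflexive.
Variables (K : fieldType) (M : kmodule K).

(** The rule sending [w] to the image of [dtens w x] under id (x) l : T (x) S -> T is T-linear and
    natural in [T], so it is an element of M^**(K); [m] is the point representing it. *)
Lemma refl_linear_points : kreflexive M -> linear_points M.
Proof.
move=> Mr S x l [lD lZ].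
pose B (T : comAlgType K) (t : T) (s : S) : T := (l s : K) *: t.
have bB (T : comAlgType K) : balanced (@B T).
  split=> [t t' s|t s s'|k t s]; rewrite /B; first by rewrite scalerDr.
    by rewrite lD scalerDl.
  by rewrite lZ scalerA mulrC.
pose tl (T : comAlgType K) : talg T S -> T := tlift (@B T).
have tlD T : addm (tl T) by exact: tliftD.
have tlE T t s : tl T (tpure t s) = (l s : K) *: t by exact: tlift_pure.
pose Phi : bidual_raw M K^o := fun T sg w => tl T (dtens w x).
have PhiE : bidual_elt Phi.
  move=> T sg sgh; split=> [w w' wh wh' e|w w' wh wh'|t w wh|T' g sg' gh e w wh]; rewrite /Phi.
  - by congr (tl _ _); apply: e; exact: tpure_inl.
  - by rewrite -tlD.
  (* By conversion, scaling [w] by [t] multiplies [dtens w x] by t (x) 1. *)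
  - rewrite -[dtens _ _]/((tpure t 1 : talg T S) * dtens w x).
    move: (dtens w x : talg T S) => z.
    apply: (talg_ext (f := fun z => tl T (tpure t 1 * z)) (g := fun z => t * tl T z)) z => [a b|a b|a b].
    + by rewrite mulrDr tlD.
    + by rewrite tlD mulrDr.
    + by rewrite tpureM mul1r !tlE scalerAr.
  - rewrite dtens_map //; have [gD _ _ gZ] := gh.
    move: (dtens w x : talg T S) => z.
    apply: (talg_ext (f := fun z => tl T' (tgmap g z)) (g := fun z => g (tl T z))) z => [a b|a b|a b].
    + by rewrite tgmapD // tlD.
    + by rewrite tlD gD.
    + by rewrite tgmap_pure // !tlE gZ.
have [_ /(_ Phi PhiE)[m mP]] := Mr K^o.
exists m => w wh.
(* For the linear form [w], [dtens] gives 1 (x) w(x), which id (x) l sends to l(w(x)). *)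
have := mP K^o _ (@kalg_hom_id K K^o) _ (dual_form (T := K^o) wh).
rewrite /bidual_ev kmap_id => ->; rewrite /Phi /dtens.
by rewrite (kmor_map wh) ?[LHS]tlE ?[LHS]mulr1 //; exact: tpure_inr.
Qed.

Hypothesis ML : linear_points M.

(** The image of [M] in the sum of [N1] and [N2] is a quasi-coherent quotient through which both
    factor. *)
Lemma lp_directed : qc_quotients_directed M.
Proof.
move=> N1 N2 q1 q2 [h1 s1 qc1] [h2 s2 qc2].
pose f S (x : M S) : ksum N1 N2 S := (q1 S x, q2 S x).
have fh : is_kmor f.
  split=> [S x y|S s x|S T g gh x]; congr (_, _).
  - exact: (kmorD h1).
  - exact: (kmorD h2).
  - exact: (kmorZ h1).
  - exact: (kmorZ h2).
  - exact: (kmor_map h1).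
  - exact: (kmor_map h2).
have [P [q [phi [qq phih phiE]]]] := qc_factor fh (ksum_qc qc1 qc2) ML.
exists P, q; split=> //.
  exists (fun S y => (phi S y).1); split=> [|S x]; last by rewrite phiE.
  split=> [S x y|S s x|S T g gh x].
  - by rewrite (kmorD phih).
  - by rewrite (kmorZ phih).
  - by rewrite (kmor_map phih).
exists (fun S y => (phi S y).2); split=> [|S x]; last by rewrite phiE.
split=> [S x y|S s x|S T g gh x].
- by rewrite (kmorD phih).
- by rewrite (kmorZ phih).
- by rewrite (kmor_map phih).
Qed.

(** If the values at [x] differed, a form [nu] and then a linear form [l] on [S] would separate
    them; the point of M(K) attached to [x] and [l] would separate [f] and [g] on M(K). *)
Lemma lp_kmor_ext (N : kmodule K) (f g : forall S, M S -> N S) : quasi_coherent N ->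
  is_kmor f -> is_kmor g -> (forall x, f K^o x = g K^o x) -> forall S x, f S x = g S x.
Proof.
move=> Nqc fh gh fg S x; apply: (qc_sep0 Nqc) => nu nuh.
have wf := is_kmor_comp fh nuh; have wg := is_kmor_comp gh nuh.
apply: contrapT => /eqP; rewrite -subr_eq0 => /eqP c0.
have s0 : subsp (fun x : S => x = 0).
  by split=> // [a b -> ->|k a ->]; rewrite ?addr0 ?scaler0.
have [l [[lD lZ] _ l1]] := @ex_functional K S _ (nu S (f S x) - nu S (g S x) : S) s0 c0.
have [//|m mP] := @ML S x l.
have e : l (nu S (f S x)) = l (nu S (g S x)).
  by rewrite -(mP _ wf) -(mP _ wg) fg.
by move: l1; rewrite (addmB lD) e subrr => /eqP; rewrite eq_sym oner_eq0.
Qed.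

(** The factorization is defined on N(K) by lifting along [q], extended by [qc_ext_kmor], and
    verified on M(K) by [lp_kmor_ext]. *)
Lemma lp_factor (N N' : kmodule K) (q : forall S, M S -> N S) (q' : forall S, M S -> N' S) :
  qc_quotient q -> qc_quotient q' -> (forall x, q K^o x = 0 -> q' K^o x = 0) ->
  factors_through q' q.
Proof.
move=> [qh qs Nqc] [qh' qs' Nqc'] ker.
have /choice[r rP] := qs K^o.
have rE x n : q K^o x = n -> q' K^o (r n) = q' K^o x.
  move=> e; apply/eqP; rewrite -subr_eq0 -(kmorB qh'); apply/eqP/ker.
  by rewrite (kmorB qh) rP e subrr.
have [||eta [etah etaE]] := qc_ext_kmor Nqc (N' := N') (theta := fun n => q' K^o (r n)).
- by move=> a b; rewrite -(kmorD qh'); apply: rE; rewrite (kmorD qh) !rP.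
- by move=> k a; rewrite -(kmorZ qh'); apply: rE; rewrite (kmorZ qh) !rP.
exists eta; split=> //; apply: (lp_kmor_ext Nqc' (is_kmor_comp qh etah) qh') => x.
by rewrite etaE; exact: rE.
Qed.

(** By [lp_factor] a quotient is determined by its kernel on M(K); the predicates on M(K) arising as
    kernels form the small index type. *)
Lemma lp_small : qc_quotients_small M.
Proof.
pose Q (P : M K^o -> Prop) (Nq : {N : kmodule K & forall S, M S -> N S}) :=
  qc_quotient (projT2 Nq) /\ forall x, P x <-> projT2 Nq K^o x = 0.
pose I := {P : M K^o -> Prop | exists Nq, Q P Nq}.
pose F (i : I) := sval (cid (svalP i)).
have FP (i : I) : Q (sval i) (F i) by exact: svalP (cid (svalP i)).
exists I, (fun i => projT1 (F i)), (fun i => projT2 (F i)); split=> [i|N' q' qq'].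
  exact: (FP i).1.
have ex : exists Nq, Q (fun x => q' K^o x = 0) Nq.
  by exists (existT (fun N : kmodule K => forall S, M S -> N S) N' q').
pose i : I := exist (fun P => exists Nq, Q P Nq) _ ex.
exists i; have [qq ker] := FP i.
by split; apply: lp_factor => // x /ker.
Qed.

Section LimitValue.
Variables (S : comAlgType K) (x : qlim_raw M S).
Hypothesis xE : qlim_elt x.

(* A compatible family indexed by the quotients takes a well-defined value on
   every morphism to a quasi-coherent module, since its image is a quotient. *)
Lemma lim_value : exists xi : forall N : kmodule K, (forall S', M S' -> N S') -> N S,
  forall (N P : kmodule K) (f : forall S', M S' -> N S') (q : forall S', M S' -> P S')
    (phi : forall S', P S' -> N S'),
    qc_quotient q -> is_kmor phi -> (forall S' y, phi S' (q S' y) = f S' y) ->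
    xi N f = phi S (x q).
Proof.
have H (N : kmodule K) (f : forall S', M S' -> N S') : exists z : N S,
    forall (P : kmodule K) (q : forall S', M S' -> P S') (phi : forall S', P S' -> N S'),
    qc_quotient q -> is_kmor phi -> (forall S' y, phi S' (q S' y) = f S' y) ->
    z = phi S (x q).
  have [[P [q [phi [qq ph pf]]]]|nP] := lem (exists (P : kmodule K)
      (q : forall S', M S' -> P S') (phi : forall S', P S' -> N S'),
      [/\ qc_quotient q, is_kmor phi & forall S' y, phi S' (q S' y) = f S' y]); last first.
    by exists 0 => P q phi *; case: nP; exists P, q, phi.
  exists (phi S (x q)) => P' q' phi' qq' ph' pf'.
  (* Independence of the factorization: both values are computed from [x q3] on a common quotient,
     and they equal f(y) for any [y] lifting [x q3]. *)
  have [P3 [q3 [qq3 [a [ah aE]] [b [bh bE]]]]] := lp_directed qq qq'.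
  rewrite -(xE qq3 qq ah aE) -(xE qq3 qq' bh bE).
  have [_ s3 _] := qq3; have [y <-] := s3 S (x q3).
  by rewrite aE bE pf pf'.
exists (fun N f => sval (cid (H N f))) => N P f q phi.
exact: svalP (cid (H N f)) P q phi.
Qed.

End LimitValue.

(** A compatible family has a value on every [dtens w] by [lim_value], hence defines an element of
    M^**(S); the point of M(S) representing it is checked against linear forms on each quotient. *)
Lemma refl_lim : kreflexive M -> qlim_iso M.
Proof.
move=> Mr S; split=> [m m' mm'|x xE].
  have [inj _] := Mr S; apply: inj => T sg sgh w wh; rewrite /bidual_ev.
  have dh := dtens_mor wh; have idh := @kalg_hom_id K T.
  rewrite -!(dtensK wh idh) !(kmor_map dh) //.
  have [P [q [phi [qq ph pf]]]] := qc_factor dh (@ktens_qc K T) ML.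
  by rewrite -!pf (mm' _ _ qq).
have [xi xiP] := lim_value xE.
have idT T := @kalg_hom_id K T.
(* The value of [dtens w] on the family lies in T (x) S; it is carried to T (x) T along [sg] and
   multiplied out. *)
pose Phi : bidual_raw M S := fun T sg w =>
  contract (fun t => t) (kmap sg (xi (ktens T) (dtens w))).
have PhiE : bidual_elt Phi.
  move=> T sg sgh; split=> [w w' wh wh' e|w w' wh wh'|t w wh|T' g sg' gh e w wh]; rewrite /Phi.
  - have [P [q [phi [qq ph pf]]]] := qc_factor (dtens_mor wh) (@ktens_qc K T) ML.
    rewrite (xiP _ _ _ _ _ qq ph pf) (xiP _ _ _ _ _ qq ph) // => U y.
    by rewrite pf; exact: (e (talg T U) _ (tpure_inl T U)).
  - have [P [q [phi [qq ph pf]]]] := qc_factor (dtens_mor wh) (@ktens_qc K T) ML.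
    have [P' [q' [phi' [qq' ph' pf']]]] := qc_factor (dtens_mor wh') (@ktens_qc K T) ML.
    (* On a common quotient [P3] the three values are those of two morphisms and of their sum at one
       point. *)
    have [P3 [q3 [qq3 [a [ah aE]] [b [bh bE]]]]] := lp_directed qq qq'.
    have pah := is_kmor_comp ah ph; have pbh := is_kmor_comp bh ph'.
    rewrite (xiP _ _ (dtens w) _ _ qq3 pah) => [|U y]; last by rewrite aE pf.
    rewrite (xiP _ _ (dtens w') _ _ qq3 pbh) => [|U y]; last by rewrite bE pf'.
    rewrite (xiP _ _ (dtens (dual_add w w')) _ _ qq3 (is_kmor_add pah pbh))
      => [|U y]; last by rewrite aE bE pf pf'.
    by rewrite kmap_add // contractD.
  - have [P [q [phi [qq ph pf]]]] := qc_factor (dtens_mor wh) (@ktens_qc K T) ML.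
    rewrite (xiP _ _ _ _ _ qq ph pf).
    have sh := dtens_scale_mor t.
    rewrite (xiP _ _ _ _ _ qq (is_kmor_comp ph sh)) => [|U y]; last by rewrite pf.
    rewrite -(kmor_map sh) //; have [_ cM _ _] := contract_hom (idT T).
    by rewrite cM contract_pure // mulr1.
  - have [P [q [phi [qq ph pf]]]] := qc_factor (dtens_mor wh) (@ktens_qc K T) ML.
    rewrite (xiP _ _ _ _ _ qq ph pf).
    have gm := tgmap_mor gh.
    rewrite (xiP _ _ _ _ _ qq (is_kmor_comp ph gm)) => [|U y]; last by rewrite pf dtens_map.
    rewrite (_ : sg' = fun s => g (sg s)); last by apply: funext.
    rewrite kmap_comp // -!(kmor_map gm) //.
    move: (kmap sg (phi S (x P q)) : talg T T) => z.
    have [gD gM _ _] := gh.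
    apply: (talg_ext (f := fun z : talg T T => contract (fun t => t) (tgmap g (tmap g z) : talg T' T'))
      (g := fun z => g (contract (fun t => t) z))) z => [a b|a b|a b].
    + by rewrite [tmap _ _]tmapD ?tgmapD ?contractD //; exact: kalg_hom_klin.
    + by rewrite contractD // gD.
    + rewrite [tmap _ _]tmap_pure; last exact: kalg_hom_klin.
      by rewrite tgmap_pure // !contract_pure // gM.
have [_ /(_ Phi PhiE)[m mP]] := Mr S.
exists m => N q qq; have [qh _ Nqc] := qq; apply: (qc_sep0 Nqc) => nu nuh.
have wh := dual_form (T := S) (is_kmor_comp qh nuh).
have := mP S _ (idT S) _ wh.
rewrite /bidual_ev kmap_id => ->; rewrite /Phi kmap_id.
(* For the form [nu] after [q], [dtens] is [q] followed by n |-> 1 (x) nu(n). *)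
pose phi U (n : N U) : ktens S U := tpure 1 (nu U n : U).
have ph : is_kmor phi.
  split=> [U a b|U u a|U U' f fh a]; rewrite /phi.
  - by rewrite (kmorD nuh) tpureDr.
  - by rewrite (kmorZ nuh) [RHS]scale_pure.
  - by rewrite (kmor_map nuh) // [RHS]tmap_pure //; exact: kalg_hom_klin.
rewrite (xiP _ _ _ _ _ qq ph) => [|U y].
  by rewrite /phi contract_pure // mul1r.
rewrite /dtens (kmor_map qh) ?(kmor_map nuh) //; exact: tpure_inr.
Qed.

End Reflexive.

Theorem theorem4p5 (K : fieldType) (M : kmodule K) :
  kreflexive M <-> is_limit_of_qc_quotients M.
Proof.
split=> [Mr|[_ _ Mlim]]; last exact: lim_reflexive.
have ML := refl_linear_points Mr.
by split; [exact: lp_small|exact: lp_directed|exact: refl_lim].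
Qed.
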